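(* Let $d$ be a positive integer, let $k$ be a positive integer, and let $H$ be a reduced $d$-flat hypergraph with $n$ vertices. Then the call $\textsc{KernelizeSetCover}(H,k)$ computes, in $O(n^{2d+2})$ time, a hypergraph $H_r$ such that the instances $(H_r,k)$ and $(H,k)$ are equivalent (i.e. $H_r$ has a cover of size at most $k$ if and only if $H$ has a cover of size at most $k$) and $\|H_r\|=O(k^{d^2})$.
   Context: A hypergraph is a pair $H=(V,E)$ with $V$ a finite set and $E\subseteq 2^V$; its size is $\|H\|=\sum_{e\in E}|e|$. A cover of $H$ is a set $F\subseteq E$ such that every vertex lies in some edge of $F$. For $d\ge1$, a $d$-semi-ladder in $H$ is a pair $(W,F)$ with $W=\{w_0,\ldots,w_d\}\subseteq V$, $F=\{f_0,\ldots,f_d\}\subseteq E$, $w_i\notin f_i$ for all $i$, and $w_i\in f_j$ whenever $i<j$. $H$ is $d$-flat if it contains no $(d+1)$-semi-ladder. $H$ is reduced if $\bigcap_{e\in E}e=\emptyset$. $H$ is intersection-closed if $V\in E$ and $E$ is closed under pairwise intersection; the intersection-closure of $H$ is the smallest intersection-closed hypergraph $H'=(V,E')$ with $E\subseteq E'$. For $e\in E'$, an $e$-chain in $H'$ is a sequence $e_0\subsetneq e_1\subsetneq\cdots\subsetneq e_l$ of edges of $H'$ with $e_l=e$, of length $l$; $l_{H'}(e)$ is the maximum length of an $e$-chain in $H'$. For $S\subseteq V$, $\textsc{Group}(H,S)$ is the hypergraph $(V',E'')$ where $V'=(V\setminus S)\cup\{v\}$ for a new vertex $v\notin V$, and $E''$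 consists of $e\setminus S$ for each $e\in E$ with $S\not\subseteq e$, and $(e\setminus S)\cup\{v\}$ for each $e\in E$ with $S\subseteq e$. The procedure $\textsc{KernelizeSetCover}(H,k)$ repeats the following: let $H'=(V',E')$ be the intersection-closure of the current $H$, and let $Z=\{(e,i): e\in E',\ i>0,\ l_{H'}(e)=i,\ |e|>k^{i-1}\}$. If $Z=\emptyset$, stop and return the current $H$. Otherwise choose $(e,i)\in Z$ with $i$ minimum and replace $H$ by $\textsc{Group}(H,e)$. *)

(* Defs.v *)
From HB Require Import structures.
From mathcomp Require Import all_boot.

Set Implicit Arguments.
Unset Strict Implicit.
Unset Printing Implicit Defensive.

(* The vertex set is the whole finite type, since grouping changes it. *)
Record hypergraph := Hypergraph {
  vertex : finType;
  edges : {set {set vertex}}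
}.

Definition hsize (H : hypergraph) : nat := \sum_(e in edges H) #|e|.

Definition is_cover (H : hypergraph) (F : {set {set vertex H}}) : bool :=
  (F \subset edges H) && [forall x : vertex H, [exists e in F, x \in e]].

Definition has_cover (H : hypergraph) (k : nat) : Prop :=
  exists F : {set {set vertex H}}, is_cover F /\ #|F| <= k.

(* The conditions force the w i, and likewise the f i, to be distinct. *)
Definition semi_ladder (H : hypergraph) (d : nat)
    (w : 'I_d.+1 -> vertex H) (f : 'I_d.+1 -> {set vertex H}) : Prop :=
  [/\ forall i, f i \in edges H,
      forall i, w i \notin f i &
      forall i j : 'I_d.+1, i < j -> w i \in f j].

Definition flat (d : nat) (H : hypergraph) : Prop :=
  ~ exists (w : 'I_d.+2 -> vertex H) (f : 'I_d.+2 -> {set vertex H}),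
      semi_ladder w f.

(* An empty family of edges has the whole vertex set as its intersection. *)
Definition reduced (H : hypergraph) : bool :=
  \bigcap_(e in edges H) e == set0.

Section Levels.

Variable T : finType.
Implicit Types (E : {set {set T}}) (e : {set T}).

Definition intersection_closed E : bool :=
  ([set: T] \in E) && [forall a in E, forall b in E, a :&: b \in E].

Definition intersection_closure E : {set {set T}} :=
  \bigcap_(E' : {set {set T}} | intersection_closed E' && (E \subset E')) E'.

Definition is_chain E e (s : seq {set T}) : bool :=
  [&& all (mem E) s, sorted (fun a b : {set T} => a \proper b) s
    & last set0 s == e].

(* A chain of length l has l.+1 members, the last of cardinality at least l;
   hence lengths above #|T| need not be considered. *)
Definition level E e : nat :=
  \max_(l < #|T|.+1 | [exists s : l.+1.-tuple {set T}, is_chain E e s]) l.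

End Levels.

Definition group_edge (T : finType) (S e : {set T}) :
    {set option {x : T | x \notin S}} :=
  [set u | if u is Some x then val x \in e else S \subset e].

(* None is the new vertex. *)
Definition group (H : hypergraph) (S : {set vertex H}) : hypergraph :=
  @Hypergraph (option {x : vertex H | x \notin S})
              [set group_edge S e | e in edges H].

Definition in_Z (k : nat) (H : hypergraph) (e : {set vertex H}) (i : nat) :
    bool :=
  let E' := intersection_closure (edges H) in
  [&& e \in E', 0 < i, level E' e == i & k ^ i.-1 < #|e|].

Definition kernelize_step (k : nat) (H H1 : hypergraph) : Prop :=
  exists (e : {set vertex H}) (i : nat),
    [/\ in_Z k e i,
        forall (e' : {set vertex H}) (i' : nat), in_Z k e' i' -> i <= i'
      & H1 = group e].

(* kernelize_set_cover k H Hr: some run of the procedure, started on H,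
   returns Hr. *)
Inductive kernelize_set_cover (k : nat) : hypergraph -> hypergraph -> Prop :=
| kernelize_stop (H : hypergraph) :
    (forall (e : {set vertex H}) (i : nat), ~~ in_Z k e i) ->
    kernelize_set_cover k H H
| kernelize_next (H H1 Hr : hypergraph) :
    kernelize_step k H H1 ->
    kernelize_set_cover k H1 Hr ->
    kernelize_set_cover k H Hr.

(* Running time is measured on a unit-cost random access machine whose only
   arithmetic is addition and truncated subtraction, in the manner of Cook and
   Reckhow but with structured control flow. A program mentions finitely many
   registers, and addresses an unbounded memory indirectly through them. *)
Record state := State { reg : nat -> nat; mem_at : nat -> nat }.

Definition update (f : nat -> nat) (a v : nat) : nat -> nat :=
  fun b => if b == a then v else f b.

Inductive expr :=
| Lit of nat
| Reg of nat
| Mem of expr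
| Add of expr & expr
| Sub of expr & expr.

Fixpoint eval (s : state) (a : expr) : nat :=
  match a with
  | Lit n => n
  | Reg x => reg s x
  | Mem b => mem_at s (eval s b)
  | Add b c => eval s b + eval s c
  | Sub b c => eval s b - eval s c
  end.

Fixpoint cost (a : expr) : nat :=
  match a with
  | Lit _ | Reg _ => 1
  | Mem b => (cost b).+1
  | Add b c | Sub b c => (cost b + cost c).+1
  end.

Inductive program :=
| Skip
| Assign of nat & expr
| Store of expr & expr
| Seq of program & program
| If of expr & program & program
| While of expr & program.

(* exec p s t s': started in s, p halts in s' after t elementary steps. Tests
   succeed on nonzero values. *)
Inductive exec : program -> state -> nat -> state -> Prop :=
| exec_skip s : exec Skip s 1 s
| exec_assign s x a :
    exec (Assign x a) s (cost a).+1
      (State (update (reg s) x (eval s a)) (mem_at s))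
| exec_store s a b :
    exec (Store a b) s (cost a + cost b).+1
      (State (reg s) (update (mem_at s) (eval s a) (eval s b)))
| exec_seq p q s s1 s2 t1 t2 :
    exec p s t1 s1 -> exec q s1 t2 s2 -> exec (Seq p q) s (t1 + t2).+1 s2
| exec_if_true a p q s s1 t :
    eval s a != 0 -> exec p s t s1 -> exec (If a p q) s (cost a + t).+1 s1
| exec_if_false a p q s s1 t :
    eval s a = 0 -> exec q s t s1 -> exec (If a p q) s (cost a + t).+1 s1
| exec_while_true a p s s1 s2 t1 t2 :
    eval s a != 0 -> exec p s t1 s1 -> exec (While a p) s1 t2 s2 ->
    exec (While a p) s (cost a + t1 + t2).+1 s2
| exec_while_false a p s :
    eval s a = 0 -> exec (While a p) s (cost a).+1 s.

(* Register 0 holds the number of vertices, register 1 the number of edges, and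
   the memory holds from address 0 on the 0/1 incidence matrix, one row per
   edge, for some enumeration v of the vertices and some enumeration f of the
   edges (injectivity makes both bijective, and no edge is listed twice). *)
Definition represents (s : state) (H : hypergraph) : Prop :=
  [/\ reg s 0 = #|vertex H|,
      reg s 1 = #|edges H| &
      exists (v : 'I_#|vertex H| -> vertex H)
             (f : 'I_#|edges H| -> {set vertex H}),
        [/\ injective v, injective f, forall i, f i \in edges H &
            forall (i : 'I_#|edges H|) (j : 'I_#|vertex H|),
              mem_at s (i * #|vertex H| + j) = (v j \in f i)]].

(* The parameter k is in register 2; everything else is initially zero. *)
Definition input_state (s : state) (H : hypergraph) (k : nat) : Prop :=
  [/\ represents s H,
      reg s 2 = k,
      forall x, 2 < x -> reg s x = 0 &
      forall a, #|edges H| * #|vertex H| <= a -> mem_at s a = 0].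

(* Main.v *)
(** An edge e of level i that violates |e| <= k^(i-1), with i minimal, meets any edge
    not containing it in a closed set of lower level, hence in at most k^(i-2)
    vertices, or none if i = 1; so a cover of size k has an edge that contains e, and grouping e
    preserves the existence of such a cover. Chains of closed sets of length l give
    semi-ladders of l points, so all levels are at most d + 1, and the vertex set
    itself bounds n by k^d when no edge violates its bound. A closed set of level
    l + 1 is the closure of a + x for some a of level l and each x outside a in it;
    counting the pairs (a, x) gives sum (|e| + 1) <= (2n)^l over the closed sets of
    level l, whence the size bound and the O(n^d) bound on the number of closed sets.

    The machine lists the closed sets once, as successors cl (a + x) of listed ones.
    Grouping maps closed sets onto closed sets, so it is done in place on this list:
    a grouped column is zeroed, except for one that stands for the new vertex.
    Levels are recomputed before each grouping, at most n times. *)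

Require Import Defs.
From HB Require Import structures.
From mathcomp Require Import all_boot.
From mathcomp Require Import zify.
Import Defs.

Set Implicit Arguments.
Unset Strict Implicit.
Unset Printing Implicit Defensive.

(** * Closed sets and their levels *)

(** The exponent 2d + 2 comes from (n X)^2, where X = O(n^d) is the number of closed sets. Both
    stages just fit. A list of X sets has n X successors, each computed and compared in time O(n X).
    Each of the at most n groupings may spend O(n X^2), the price of comparing all listed sets
    pairwise once per level. Closing the family anew after every grouping would cost another factor
    n, so the list is carried along instead. Being d-flat forbids d + 2 ladder points, so V may have
    level d + 1, but every other closed set has level at most d. Setting V apart in the counts makes
    the exponent of n equal to d and not d + 1. Grouping can make rows equal, and it leaves columns
    that stand for no vertex. Neither is repaired before the output: levels depend only on the set
    of rows, and a hypergraph is related to the memory through an injection of its vertices into the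
    columns. The program is the same for all d, which enters only its analysis. *)

Section Closure.

Variable T : finType.
Implicit Types (E : {set {set T}}) (a b e : {set T}).

(** Over no edge the intersection is [setT]; thus the vertex set is a fixed point of [cl E], as it
    must be to be closed. *)
Definition cl E a : {set T} := \bigcap_(e in E | a \subset e) e.

Lemma sub_cl E a : a \subset cl E a.
Proof. by apply/bigcapsP => e /andP[]. Qed.

Lemma clS E a b : a \subset b -> cl E a \subset cl E b.
Proof.
move=> ab; apply/bigcapsP => e /andP[eE be].
by apply: bigcap_inf; rewrite eE (subset_trans ab).
Qed.

Lemma closure_closed E : intersection_closed (intersection_closure E).
Proof.
apply/andP; split.
  by apply/bigcapP => E' /andP[/andP[]].
apply/forall_inP => a /bigcapP aE; apply/forall_inP => b /bigcapP bE.
apply/bigcapP => E' hE; have /andP[/andP[_ /forall_inP h] _] := hE.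
by move/forall_inP: (h a (aE _ hE)); apply; apply: bE.
Qed.

Lemma closureT E : setT \in intersection_closure E.
Proof. by case/andP: (closure_closed E). Qed.

Lemma closureI E a b :
  a \in intersection_closure E -> b \in intersection_closure E ->
  a :&: b \in intersection_closure E.
Proof.
move=> aE bE; case/andP: (closure_closed E) => _ /forall_inP h.
by move/forall_inP: (h a aE); apply.
Qed.

Lemma sub_closure E : E \subset intersection_closure E.
Proof. by apply/bigcapsP => E' /andP[]. Qed.

Lemma closure_min E F :
  intersection_closed F -> E \subset F -> intersection_closure E \subset F.
Proof. by move=> h1 h2; apply: bigcap_inf; rewrite h1. Qed.

Lemma cl_closure E a : cl E a \in intersection_closure E.
Proof.
apply: (big_ind (fun x => x \in intersection_closure E)); [exact: closureT | exact: closureI |].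
by move=> e /andP[eE _]; apply: (subsetP (sub_closure E)).
Qed.

(** The fixed points of [cl E] form an intersection-closed family above [E], so the closure, being
    minimal, lies inside it. *)
Lemma mem_closure E a : (a \in intersection_closure E) = (cl E a == a).
Proof.
apply/idP/eqP => [aE | <-]; last exact: cl_closure.
suff /subsetP/(_ a aE) : intersection_closure E \subset [set b | cl E b == b].
  by rewrite inE => /eqP.
apply: closure_min.
  apply/andP; split.
    by rewrite inE eqEsubset subsetT sub_cl.
  apply/forall_inP => b; rewrite inE => /eqP hb.
  apply/forall_inP => c; rewrite inE => /eqP hc.
  rewrite inE eqEsubset sub_cl andbT subsetI -{2}hb -{3}hc.
  by rewrite !clS ?subsetIl ?subsetIr.
apply/subsetP => e eE; rewrite inE eqEsubset sub_cl andbT.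
by apply: bigcap_inf; rewrite eE /=.
Qed.

Lemma cl_min E a b :
  b \in intersection_closure E -> a \subset b -> cl E a \subset b.
Proof. by rewrite mem_closure => /eqP h ab; rewrite -h clS. Qed.

(** A closed set is the intersection of the edges above it. This is how a chain of closed sets gives
    rise to edges of the hypergraph itself. *)
Lemma closure_separates E a x :
  a \in intersection_closure E -> x \notin a ->
  exists e, [/\ e \in E, a \subset e & x \notin e].
Proof.
rewrite mem_closure => /eqP ha xa.
case: (boolP [exists e in E, (a \subset e) && (x \notin e)]) => [|/exists_inPn h].
  by case/exists_inP => e eE /andP[? ?]; exists e.
case/negP: xa; rewrite -ha; apply/bigcapP => e /andP[eE ae].
by move: (h e eE); rewrite ae /= negbK.
Qed.

End Closure.

(** Minimality is applied on both sides: the image of the closure is closed, and so is the family of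
    sets whose image lies in the closure of the image. It serves for grouping and for renaming
    vertices as columns. *)
Lemma closure_imset (T T' : finType) (phi : {set T} -> {set T'})
    (E : {set {set T}}) :
  phi setT = setT -> {morph phi : a b / a :&: b} ->
  intersection_closure [set phi e | e in E]
    = [set phi e | e in intersection_closure E].
Proof.
move=> phiT phiI; apply/eqP; rewrite eqEsubset; apply/andP; split.
  apply: closure_min; last exact: imsetS (sub_closure E).
  apply/andP; split; first by rewrite -phiT imset_f // closureT.
  apply/forall_inP => _ /imsetP[a aE ->]; apply/forall_inP => _ /imsetP[b bE ->].
  by rewrite -phiI imset_f // closureI.
set F := intersection_closure [set phi e | e in E].
suff /subsetP h : intersection_closure E \subset [set e | phi e \in F].
  by apply/subsetP => _ /imsetP[e /h + ->]; rewrite inE.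
apply: closure_min.
  apply/andP; split; first by rewrite inE phiT closureT.
  apply/forall_inP => a; rewrite inE => aF; apply/forall_inP => b.
  by rewrite !inE => bF; rewrite phiI closureI.
by apply/subsetP => e eE; rewrite inE (subsetP (sub_closure _)) // imset_f.
Qed.

(** * Chains and levels *)

Section Depth.

Variable T : finType.
Implicit Types (E : {set {set T}}) (a b e : {set T}).

(** Existence of a chain of length [l] that ends in [e], by recursion from its top; the tuples in
    [level] do not lend themselves to induction. *)
Fixpoint deep E l e : bool :=
  (e \in E) && (if l is l'.+1 then [exists (a : {set T} | a \in E), (a \proper e) && deep E l' a]
                else true).

Lemma deep_mem E l e : deep E l e -> e \in E.
Proof. by case: l => [|l] /= /andP[]. Qed.

Lemma deepSP E l e :
  reflect (e \in E /\ exists2 a : {set T}, a \proper e & deep E l a) (deep E l.+1 e).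
Proof.
apply: (iffP andP) => [[eE /exists_inP[a aE /andP[? ?]]] | [eE [a ae da]]].
  by split=> //; exists a.
by split=> //; apply/exists_inP; exists a; rewrite ?ae ?(deep_mem da).
Qed.

Lemma deep_anti E l l' e : l <= l' -> deep E l' e -> deep E l e.
Proof.
move=> ll'; elim: l' l ll' e => [|l' IH] [|l] // ll' e; first by move/deep_mem=> /= ->.
move/deepSP=> [eE [a ae da]]; apply/deepSP; split=> //; exists a => //.
exact: IH da.
Qed.

Lemma deep_card E l e : deep E l e -> l <= #|e|.
Proof.
elim: l e => // l IH e /deepSP[_ [a /proper_card ae /IH]]; lia.
Qed.

Lemma deepP E l e :
  deep E l e <-> exists s : l.+1.-tuple {set T}, is_chain E e s.
Proof.
elim: l e => [|l IH] e /=.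
  rewrite andbT; split=> [eE | [s]].
    by exists [tuple e]; rewrite /is_chain /= eE eqxx.
  case/tupleP: s => x s; rewrite (tuple0 s) /is_chain /= andbT.
  by case/andP => xE /eqP <-.
split=> [/deepSP[eE [a ae /IH[s]]] | [s]].
  case/and3P => sE so /eqP la.
  exists [tuple of rcons s e]; apply/and3P; split.
  - by rewrite all_rcons /= eE.
  - case: s {sE} so la => [[//|x s] /= _] so la.
    by rewrite rcons_path so /= la.
  - by rewrite last_rcons.
case: s => s sz /and3P /= [sE so /eqP la].
case/lastP: s sz sE so la => // s y; rewrite size_rcons last_rcons.
move=> /eqP[sz]; rewrite all_rcons => /andP[yE sE] so ye; subst y.
case: s sz sE so => // x s sz sE; rewrite /= rcons_path => /andP[so la].
apply/deepSP; split=> //; exists (last x s) => //.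
have hs : size (x :: s) == l.+1 by rewrite sz.
by apply/IH; exists (Tuple hs); apply/and3P; split.
Qed.

(** Chain lengths are downward closed, so the maximum is determined by its thresholds; by
    [deep_card] the bounded range of the maximum cuts nothing off. *)
Lemma level_ge E l e : e \in E -> (l <= level E e) = deep E l e.
Proof.
move=> eE; have D (l0 : 'I_#|T|.+1) :
    [exists s : l0.+1.-tuple {set T}, is_chain E e s] = deep E l0 e.
  by apply/existsP/idP => /deepP.
apply/idP/idP => [|dl].
  apply: contraTT => ndl.
  have l0 : 0 < l by case: l ndl => //=; rewrite eE.
  suff : level E e <= l.-1 by lia.
  apply/bigmax_leqP => i; rewrite D => di.
  rewrite leqNgt; apply: contra ndl => li; apply: deep_anti di; lia.
have hl : l < #|T|.+1 by rewrite ltnS (leq_trans (deep_card dl)) ?max_card.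
by rewrite -[l]/(val (Ordinal hl)); apply: leq_bigmax_cond; rewrite D.
Qed.

Lemma level_proper E a e :
  a \in E -> e \in E -> a \proper e -> level E a < level E e.
Proof.
move=> aE eE ae; rewrite level_ge //; apply/deepSP; split=> //; exists a => //.
by rewrite -level_ge.
Qed.

(** The last set but one of a longest chain has level at least [l] by its own chain, and no more
    because [e] lies strictly above it. *)
Lemma levelS E e l :
  e \in E -> level E e = l.+1 ->
  exists a, [/\ a \in E, a \proper e & level E a = l].
Proof.
move=> eE le; have : deep E l.+1 e by rewrite -level_ge // le.
case/deepSP => _ [a ae da]; have aE := deep_mem da; exists a; split=> //.
have := level_proper aE eE ae; rewrite -level_ge // in da; lia.
Qed.

Lemma level0 E e : set0 \in E -> e \in E -> level E e = 0 -> e = set0.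
Proof.
move=> E0 eE le; apply/eqP; apply: contra_eqT le => e0.
by rewrite -lt0n (leq_ltn_trans _ (level_proper E0 eE _)) // proper0.
Qed.

Lemma level_set0 E : level E set0 = 0.
Proof.
case: (boolP (set0 \in E)) => E0.
  by apply/eqP; rewrite -leqn0 leqNgt level_ge //; apply/negP => /deep_card; rewrite cards0.
apply/eqP; rewrite -leqn0; apply/bigmax_leqP => i /existsP h.
by move/deepP: h => /deep_mem; rewrite (negbTE E0).
Qed.

End Depth.

Lemma level_imset (T T' : finType) (phi : {set T} -> {set T'})
    (E : {set {set T}}) e :
  (forall a b, (phi a \proper phi b) = (a \proper b)) -> injective phi ->
  e \in E -> level [set phi x | x in E] (phi e) = level E e.
Proof.
move=> phiP phi_inj eE.
have D l a : deep [set phi x | x in E] l (phi a) = deep E l a.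
  elim: l a => [|l IH] a; first by rewrite /= mem_imset.
  apply/deepSP/deepSP => [] [aE [b ba db]].
    rewrite mem_imset // in aE; split=> //.
    have /imsetP[c cE bc] := deep_mem db; subst b.
    by exists c; rewrite -?phiP -?IH.
  by rewrite mem_imset //; split=> //; exists (phi b); rewrite ?phiP ?IH.
have pE : phi e \in [set phi x | x in E] by rewrite imset_f.
apply/eqP; rewrite eqn_leq level_ge // -D -level_ge // leqnn /=.
by rewrite level_ge // D -level_ge.
Qed.

(** For consecutive sets a and e of the chain, take x in e - a and, a being closed, an edge that
    contains a and misses x. All earlier points lie in a, hence in that edge; the third conjunct
    keeps this available to the induction. Values at indices from [l] on are arbitrary. *)
Lemma deep_ladder (T : finType) (E : {set {set T}}) (x0 : T) l e :
  deep (intersection_closure E) l e ->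
  exists (w : nat -> T) (f : nat -> {set T}),
    [/\ forall i, i < l -> f i \in E, forall i, i < l -> w i \notin f i,
        forall i, i < l -> w i \in e &
        forall i j, i < j -> j < l -> w i \in f j].
Proof.
elim: l e => [|l IH] e; first by exists (fun=> x0), (fun=> set0).
case/deepSP => eE [a /properP[/subsetP sae [x xe xa]] da].
have [w [f [fE wf wa wlf]]] := IH _ da.
have [g [gE /subsetP ag xg]] := closure_separates (deep_mem da) xa.
exists (fun i => if i == l then x else w i), (fun i => if i == l then g else f i).
split=> [i|i|i|i j].
- by rewrite ltnS leq_eqVlt; case: eqP => //= _; apply: fE.
- by rewrite ltnS leq_eqVlt; case: eqP => //= _; apply: wf.
- by rewrite ltnS leq_eqVlt; case: eqP => //= _ il; apply/sae/wa.
- move=> ij; rewrite ltnS leq_eqVlt; case: (j =P l) => /= [jl _ | _ jl].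
    have il : i < l by rewrite -jl.
    by rewrite (ltn_eqF il); apply/ag/wa.
  by rewrite (ltn_eqF (ltn_trans ij jl)); apply: wlf.
Qed.

(** A chain of length d + 2 gives one ladder point per step, and [flat d] forbids d + 2 points. *)
Lemma flat_level d H e : flat d H -> e \in intersection_closure (edges H) ->
  level (intersection_closure (edges H)) e <= d.+1.
Proof.
move=> fl eE; rewrite leqNgt level_ge //; apply/negP => de; apply: fl.
have /card_gt0P[x0 _] := leq_trans (ltn0Sn _) (deep_card de).
have [w [f [fE wf _ wlf]]] := deep_ladder x0 de.
exists (fun i => w i), (fun i => f i); split=> [i|i|i j].
- exact: fE.
- exact: wf.
- by move/wlf; apply.
Qed.

Lemma reduced_closure H : reduced H -> set0 \in intersection_closure (edges H).
Proof.
move/eqP => <-; rewrite mem_closure eqEsubset sub_cl andbT.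
apply/bigcapsP => e eE; apply: (bigcap_inf e); rewrite eE /=.
exact: bigcap_inf.
Qed.

(** * Counting the closed sets *)

Section Weight.

Variables (T : finType) (E : {set {set T}}).
Hypothesis E0 : set0 \in intersection_closure E.

Local Notation E' := (intersection_closure E).

(** The added one makes the empty set count, which starts the recurrence, and lets one bound serve
    for both the number of closed sets and their total size. *)
Definition weight l : nat := \sum_(e in E' | level E' e == l) #|e|.+1.

(* An edge e of level l + 1 is cl (a + x) for some a of level l and every x in e - a. *)
Lemma weightS l : weight l.+1 <= 2 * #|T| * weight l.
Proof.
(* Each pair (a, x) pays #|a| + 2 to cl (a + x). For a fixed a below e there are r = #|e| - #|a| >=
   1 paying pairs, and r (#|a| + 2) >= #|e| + 1. Since #|a| + 2 <= 2 (#|a| + 1), the total paid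
   explains the factor 2. *)
pose g (a : {set T}) x e := (cl E (x |: a) == e) * (#|a| + 2).
have step e : (e \in E') && (level E' e == l.+1) ->
    #|e|.+1 <= \sum_(a in E' | level E' a == l) \sum_(x : T) g a x e.
  case/andP => eE /eqP le; have [a [aE ae la]] := levelS eE le.
  rewrite (bigD1 a) ?aE ?la ?eqxx //=; apply: leq_trans (leq_addr _ _).
  rewrite (bigID (mem (e :\: a))) /=; apply: leq_trans (leq_addr _ _).
  rewrite (eq_bigr (fun=> #|a| + 2)) => [|x].
    rewrite sum_nat_const cardsD (setIidPr (proper_sub ae)).
    have := proper_card ae; move: #|e| #|a| => p q qp.
    have -> : p = q + (p - q) by lia.
    rewrite addKn; have : 0 < p - q by lia.
    by move: (p - q) => r r0; nia.
  rewrite inE => /andP[xa xe]; rewrite /g.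
  have -> : cl E (x |: a) == e; last by rewrite mul1n.
  have sub : cl E (x |: a) \subset e.
    by apply: cl_min; rewrite // subUset sub1set xe proper_sub.
  (* Otherwise cl (a + x) lies strictly between a and e, whose levels are consecutive. *)
  apply: contraT => ne; have pr : cl E (x |: a) \proper e.
    by rewrite properEneq ne.
  have := level_proper (cl_closure E (x |: a)) eE pr; rewrite le ltnS leqNgt -la.
  rewrite level_proper ?cl_closure //; apply/properP; split.
    exact: subset_trans (subsetUr _ _) (sub_cl _ _).
  by exists x => //; apply: (subsetP (sub_cl _ _)); rewrite setU11.
apply: leq_trans (leq_sum _ step) _; rewrite exchange_big /= big_distrr /=.
apply: leq_sum => a _; rewrite exchange_big /=.
apply: (@leq_trans (\sum_(x : T) (#|a| + 2))); last first.
  by rewrite sum_nat_const -mulnA mulnCA leq_mul2l; lia.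
apply: leq_sum => x _; rewrite /g -big_distrl /=.
rewrite -[leqRHS]mul1n leq_mul2r; apply/orP; right.
rewrite (bigID (pred1 (cl E (x |: a)))) /= [X in _ + X]big1 ?addn0; last first.
  by move=> e /andP[_]; rewrite eq_sym => /negbTE->.
apply: (@leq_trans (\sum_(e | e == cl E (x |: a)) 1)); last by rewrite big_pred1_eq.
rewrite [leqRHS](bigID (fun e => (e \in E') && (level E' e == l.+1))) /=.
apply: leq_trans (leq_addr _ _); rewrite [leqRHS](eq_bigl _ _ (fun e => andbC _ _)).
by apply: leq_sum => e _; case: eqP.
Qed.

Lemma weight_le l : weight l <= (2 * #|T|) ^ l.
Proof.
elim: l => [|l IH]; last by rewrite expnS (leq_trans (weightS l)) // leq_mul2l IH orbT.
rewrite expn0 /weight (big_pred1 set0) ?cards0 // => e.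
apply/andP/eqP => [[eE /eqP]|->]; first exact: level0.
by rewrite E0 level_set0.
Qed.

(** Closed sets other than V lie strictly below it, so their levels are at most d and [weight_le] is
    applied with exponents up to d only. *)
Lemma closure_weight d : 0 < #|T| -> level E' setT <= d.+1 ->
  \sum_(e in E' | e != setT) #|e|.+1 <= d.+1 * (2 * #|T|) ^ d.
Proof.
move=> T0 dT.
rewrite (partition_big (fun e => inord (level E' e) : 'I_d.+1) predT) //=.
apply: (@leq_trans (\sum_(i < d.+1) (2 * #|T|) ^ d)); last by rewrite sum_nat_const card_ord.
apply: leq_sum => i _; apply: (@leq_trans ((2 * #|T|) ^ i)); last first.
  by rewrite leq_pexp2l ?muln_gt0 // -ltnS.
apply: leq_trans (weight_le i).
rewrite /weight [leqRHS](bigID (fun e => e != setT)) /=.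
apply: leq_trans (leq_addr _ _).
rewrite [leqRHS]big_mkcond /= [leqLHS]big_mkcond /=; apply: leq_sum => e _.
case: ifP => // /andP[/andP[eE eT] /eqP ie]; rewrite eE eT /= andbT.
suff -> : level E' e = i by rewrite eqxx.
rewrite -ie inordK // (leq_trans _ dT) // level_proper ?closureT //.
by rewrite properEneq eT subsetT.
Qed.

Lemma card_closure d : 0 < #|T| -> level E' setT <= d.+1 ->
  #|E'| <= (d.+1 * (2 * #|T|) ^ d).+1.
Proof.
move=> T0 dT; rewrite (cardD1 setT) closureT ltnS.
apply: leq_trans (closure_weight T0 dT); rewrite -sum1_card.
rewrite [leqLHS](eq_bigl (fun e => (e \in E') && (e != setT))); first by apply: leq_sum.
by move=> e; rewrite !inE andbC.
Qed.

Lemma size_closure d : 0 < #|T| -> level E' setT <= d.+1 ->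
  \sum_(e in E) #|e| <= #|T| + d.+1 * (2 * #|T|) ^ d.
Proof.
move=> T0 dT; apply: (@leq_trans (\sum_(e in E') #|e|)).
  rewrite [leqRHS](bigID (mem E)) /=; apply: leq_trans (leq_addr _ _).
  rewrite [leqRHS](eq_bigl (mem E)) // => e /=.
  by rewrite andbC; apply: andb_idr; apply: (subsetP (sub_closure E)).
rewrite (bigD1 setT) ?closureT //= cardsT leq_add2l.
by apply: leq_trans (closure_weight T0 dT); apply: leq_sum.
Qed.

End Weight.

(** * Grouping *)

Lemma group_edgeT (T : finType) (S : {set T}) : group_edge S setT = setT.
Proof. by apply/setP => -[x|]; rewrite !inE ?subsetT. Qed.

Lemma group_edgeI (T : finType) (S : {set T}) :
  {morph @group_edge T S : a b / a :&: b}.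
Proof. by move=> a b; apply/setP => -[x|]; rewrite !inE ?subsetI. Qed.

Lemma group_closure H S :
  intersection_closure (edges (@group H S))
    = [set group_edge S e | e in intersection_closure (edges H)].
Proof. exact: closure_imset (group_edgeT S) (@group_edgeI _ S). Qed.

Lemma group_card H (S : {set vertex H}) : #|vertex (group S)| + #|S| = #|vertex H|.+1.
Proof.
rewrite card_option card_sig addSn -(cardC (mem S)) addnC.
by congr (_ + _).+1; apply: eq_card => x; rewrite !inE.
Qed.

Lemma group_reduced H (S : {set vertex H}) : reduced H -> S != set0 -> reduced (group S).
Proof.
move=> /eqP rH /set0Pn[s sS]; apply/eqP/setP => u; rewrite inE; apply/bigcapP.
have miss x : exists2 e, e \in edges H & x \notin e.
  have : x \notin \bigcap_(e in edges H) e by rewrite rH inE.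
  by rewrite -in_setC setC_bigcap => /bigcupP[e eE]; rewrite inE; exists e.
case: u => [[x xS]|] h.
  have [e eE /negP[]] := miss x.
  by have := h _ (imset_f _ eE); rewrite inE.
have [e eE /negP[]] := miss s.
by have := h _ (imset_f _ eE); rewrite inE => /subsetP; apply.
Qed.

(** Semi-ladders lift. Where the new vertex misses an edge, some element of [S] misses the preimage
    of that edge and can replace it; an edge that contains the new vertex contains all of [S], hence
    that element too. *)
Lemma group_flat d H (S : {set vertex H}) : flat d H -> flat d (group S).
Proof.
move=> fl [w [f [fE wf wlf]]]; apply: fl.
have /fin_all_exists2[g gE fg] : forall i, exists2 e, e \in edges H & f i = group_edge S e.
  by move=> i; case/imsetP: (fE i) => e; exists e.
have /fin_all_exists2[w' wg' wsub] : forall i, exists2 x, x \notin g i &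
    forall e, w i \in group_edge S e -> x \in e.
  move=> i; have := wf i; rewrite fg inE; case: (w i) => [[x xS] /= xg|].
    by exists x => // e; rewrite inE.
  by case/subsetPn => x xS xg; exists x => // e; rewrite inE => /subsetP; apply.
by exists w', g; split=> // i j ij; apply: wsub; rewrite -fg wlf.
Qed.

(** * Covers, termination and the size of the kernel *)

Section Covers.

Variables (H : hypergraph) (k : nat).
Hypothesis rH : reduced H.

Local Notation E' := (intersection_closure (edges H)).

Definition min_Z (e : {set vertex H}) i :=
  in_Z k e i /\ forall (e' : {set vertex H}) i', in_Z k e' i' -> i <= i'.

(** A closed set of lower level is not in Z, by minimality. The factor [k] stands on the left so
    that i = 1 is included: there the set is empty, while k^(i-2) would be 1 under truncated
    subtraction. *)
Lemma min_Z_small e i a : 0 < k -> min_Z e i -> a \in E' -> level E' a < i ->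
  k * #|a| <= k ^ i.-1.
Proof.
move=> k0 [/and4P[eE i0 /eqP le ke] mZ] aE la.
case: (posnP (level E' a)) => [l0 | l0].
  by rewrite (level0 (reduced_closure rH) aE l0) cards0 muln0.
have : ~~ in_Z k a (level E' a).
  by apply/negP => /mZ; rewrite leqNgt la.
rewrite /in_Z aE l0 eqxx /= -leqNgt => h.
apply: (@leq_trans (k * k ^ (level E' a).-1)); first by rewrite leq_mul2l h orbT.
by rewrite -expnS leq_pexp2l //; lia.
Qed.

Lemma cover_contains e i (F : {set {set vertex H}}) : 0 < k -> min_Z e i ->
  is_cover F -> #|F| <= k -> exists2 f, f \in F & e \subset f.
Proof.
move=> k0 mZ /andP[/subsetP FE /forallP cF] Fk.
have [/and4P[eE i0 /eqP le ke] _] := mZ.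
case: (boolP [exists f in F, e \subset f]) => [/exists_inP[f] | /exists_inPn nF].
  by exists f.
have small f : f \in F -> k * #|f :&: e| <= k ^ i.-1.
  move=> fF; have fE := subsetP (sub_closure _) _ (FE _ fF).
  apply: (min_Z_small k0 mZ); first exact: closureI.
  rewrite -le; apply: level_proper => //; first exact: closureI.
  rewrite properEneq subsetIr andbT; apply: contra (nF f fF) => /eqP/setIidPr.
  by [].
(* The traces of the edges of [F] cover e. There are at most k of them, so k #|e| <= k * k^(i-1),
   against #|e| > k^(i-1). *)
have : e \subset \bigcup_(f in F) (f :&: e).
  apply/subsetP => x xe; case/exists_inP: (cF x) => f fF xf.
  by apply/bigcupP; exists f; rewrite // inE xf.
move/subset_leq_card; rewrite leqNgt => /negP[]; apply: leq_ltn_trans ke.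
apply: (@leq_trans (\sum_(f in F) #|f :&: e|)).
  apply: (big_ind2 (fun (A : {set vertex H}) n => #|A| <= n)) => // [|A p B q Ap Bq].
    by rewrite cards0.
  by apply: leq_trans (leq_add Ap Bq); rewrite cardsU leq_subr.
rewrite -(leq_pmul2l k0) big_distrr /=.
apply: leq_trans (leq_sum _ small) _.
by rewrite sum_nat_const leq_mul2r Fk orbT.
Qed.

(** Preimages of a cover are a cover, as an edge through the new vertex comes from one that contains
    e. Conversely only the new vertex could stay uncovered, and [cover_contains] provides the edge
    for it. *)
Lemma group_cover e i : 0 < k -> min_Z e i ->
  has_cover (group e) k <-> has_cover H k.
Proof.
move=> k0 mZ; split=> -[F [cF Fk]].
  have [/subsetP FE /forallP cov] := andP cF.
  have /fin_all_exists[h hP] : forall g : {set vertex (group e)},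
      exists f, g \in F -> f \in edges H /\ g = group_edge e f.
    move=> g; case: (boolP (g \in F)) => [/FE/imsetP[f fE ->]|_]; last by exists set0.
    by exists f.
  exists [set h g | g in F]; split; last exact: leq_trans (leq_imset_card _ _) Fk.
  apply/andP; split.
    by apply/subsetP => _ /imsetP[g gF ->]; case: (hP g gF).
  apply/forallP => x; apply/exists_inP.
  have [u uP] : exists u : vertex (group e), forall f, u \in group_edge e f -> x \in f.
    case: (boolP (x \in e)) => xe.
      by exists None => f; rewrite inE => /subsetP; apply.
    by exists (Some (exist _ x xe)) => f; rewrite inE.
  case/exists_inP: (cov u) => g gF ug; exists (h g); first exact: imset_f.
  by apply: uP; rewrite -(hP g gF).2.
have [f fF ef] := cover_contains k0 mZ cF Fk.
have [/subsetP FE /forallP cov] := andP cF.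
exists [set group_edge e f | f in F]; split; last exact: leq_trans (leq_imset_card _ _) Fk.
apply/andP; split; first by apply/subsetP => _ /imsetP[g /FE gE ->]; apply: imset_f.
apply/forallP => -[[x xe]|]; apply/exists_inP.
  by case/exists_inP: (cov x) => g gF xg; exists (group_edge e g); rewrite ?imset_f // inE.
by exists (group_edge e f); rewrite ?imset_f // inE.
Qed.

End Covers.

(** Grouping replaces #|e| vertices by one; two or more make the number of vertices drop, and this
    is the termination measure. *)
Lemma min_Z_card k H (e : {set vertex H}) i : 0 < k -> min_Z k e i -> 1 < #|e|.
Proof.
move=> k0 [/and4P[_ _ _ ke] _]; apply: leq_trans ke.
by rewrite ltnS expn_gt0 k0.
Qed.

Lemma kernelize_stepP k H H1 : kernelize_step k H H1 <->
  exists (e : {set vertex H}) i, min_Z k e i /\ H1 = group e.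
Proof.
by split=> -[e [i]] => [[h1 h2 h3] | [[h1 h2] h3]]; exists e, i.
Qed.

Lemma kernelize_step_invariant k d H H1 : 0 < k -> reduced H -> flat d H ->
  kernelize_step k H H1 ->
  [/\ reduced H1, flat d H1, has_cover H1 k <-> has_cover H k
    & #|vertex H1| < #|vertex H|].
Proof.
move=> k0 rH fH /kernelize_stepP[e [i [mZ ->]]].
have ce := min_Z_card k0 mZ; split.
- by apply: group_reduced; rewrite // -card_gt0 ltnW.
- exact: group_flat.
- exact: group_cover mZ.
- by have := group_card e; lia.
Qed.

(** [kernelize_set_cover] speaks of finished runs only; accessibility says that no choice of edges
    leads to an infinite one. *)
Lemma kernelize_acc k d H : 0 < k -> reduced H -> flat d H ->
  Acc (fun H2 H1 : hypergraph => kernelize_step k H1 H2) H.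
Proof.
move=> k0; move: {2}#|vertex H| (leqnn #|vertex H|) => n.
elim: n H => [|n IH] H nH rH fH; constructor=> H1 st.
all: have [r1 f1 _ c1] := kernelize_step_invariant k0 rH fH st.
  by have := leq_trans c1 nH.
by apply: IH r1 f1; rewrite -ltnS (leq_trans c1 nH).
Qed.

Lemma kernel_vertices k d H : 0 < k -> reduced H -> flat d H ->
  (forall (e : {set vertex H}) i, ~~ in_Z k e i) -> #|vertex H| <= k ^ d.
Proof.
move=> k0 rH fH nZ; set E' := intersection_closure (edges H).
have tE : setT \in E' := closureT _.
case: (posnP (level E' setT)) => [l0 | l0].
  by rewrite -cardsT (level0 (reduced_closure rH) tE l0) cards0.
have := nZ setT (level E' setT); rewrite /in_Z tE l0 eqxx /= -leqNgt cardsT.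
move=> /leq_trans; apply; rewrite leq_pexp2l //.
by have := flat_level fH tE; rewrite -/E'; lia.
Qed.

(** The constant is that of [size_closure], n + (d+1) (2n)^d, once n <= k^d is inserted. *)
Lemma kernel_size k d H : 0 < d -> 0 < k -> reduced H -> flat d H ->
  (forall (e : {set vertex H}) i, ~~ in_Z k e i) ->
  hsize H <= (1 + d.+1 * 2 ^ d) * k ^ (d ^ 2).
Proof.
move=> d0 k0 rH fH nZ; have nk := kernel_vertices k0 rH fH nZ.
case: (posnP #|vertex H|) => [n0 | n0].
  rewrite /hsize big1 // => e _; apply/eqP.
  by rewrite -leqn0 -n0 max_card.
have lT := flat_level fH (closureT _).
apply: leq_trans (size_closure (reduced_closure rH) n0 lT) _.
rewrite mulnDl mul1n -mulnA leq_add //.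
  by apply: leq_trans nk _; rewrite leq_pexp2l // -mulnn leq_pmulr.
rewrite leq_mul2l expnMn leq_mul2l -mulnn expnM.
by rewrite leq_exp2r // nk !orbT.
Qed.

Lemma kernelize_correct k d H Hr : 0 < d -> 0 < k -> reduced H -> flat d H ->
  kernelize_set_cover k H Hr ->
  (has_cover Hr k <-> has_cover H k) /\
  hsize Hr <= (1 + d.+1 * 2 ^ d) * k ^ (d ^ 2).
Proof.
move=> d0 k0 rH fH run; elim: run rH fH => {H Hr} [H nZ | H H1 Hr st _ IH] rH fH.
  by split=> //; apply: kernel_size.
have [r1 f1 e1 _] := kernelize_step_invariant k0 rH fH st.
by have [e2 ?] := IH r1 f1; split=> //; rewrite e2.
Qed.

(** * Programs *)

(** A halting execution is asserted, so termination, time and result are proved together. *)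
Definition wp p c (Q : state -> Prop) s :=
  exists t s', [/\ exec p s t s', t <= c & Q s'].

Fixpoint writes p : seq nat :=
  match p with
  | Assign x _ => [:: x]
  | Seq p q | If _ p q => writes p ++ writes q
  | While _ p => writes p
  | _ => [::]
  end.

Fixpoint nostore p : bool :=
  match p with
  | Store _ _ => false
  | Seq p q | If _ p q => nostore p && nostore q
  | While _ p => nostore p
  | _ => true
  end.

Definition setr s x v := State (update (reg s) x v) (mem_at s).

(** Read off from the program text, so that invariants need to mention only what changes, and
    preservation is settled by computation. *)
Definition frame p s s' :=
  (forall x, x \notin writes p -> reg s' x = reg s x) /\
  (nostore p -> mem_at s' = mem_at s).

Lemma exec_frame p s t s' : exec p s t s' -> frame p s s'.
Proof.
elim => {p s t s'} //=.
- move=> s x a; split=> //= y; rewrite inE /update => /negbTE->; exact: erefl.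
- move=> p q s s1 s2 t1 t2 _ [r1 m1] _ [r2 m2]; split=> [x|].
    by rewrite mem_cat negb_or => /andP[? ?]; rewrite r2 ?r1.
  by case/andP => ? ?; rewrite m2 ?m1.
- move=> a p q s s1 t _ _ [r1 m1]; split=> [x|/andP[? _]]; last exact: m1.
  by rewrite mem_cat negb_or => /andP[? ?]; rewrite r1.
- move=> a p q s s1 t _ _ [r1 m1]; split=> [x|/andP[_ ?]]; last exact: m1.
  by rewrite mem_cat negb_or => /andP[? ?]; rewrite r1.
- move=> a p s s1 s2 t1 t2 _ _ [r1 m1] _ [r2 m2]; split=> [x hx|h].
    by rewrite r2 ?r1.
  by rewrite m2 ?m1.
Qed.

Lemma wp_conseq p c c' (Q Q' : state -> Prop) s :
  wp p c Q s -> c <= c' -> (forall s', Q s' -> frame p s s' -> Q' s') -> wp p c' Q' s.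
Proof.
case=> t [s' [ex tc q]] cc h; exists t, s'; split=> //; first exact: leq_trans cc.
by apply: h q (exec_frame ex).
Qed.

Lemma wp_skip c (Q : state -> Prop) s : Q s -> 0 < c -> wp Skip c Q s.
Proof. by move=> q c0; exists 1, s; split=> //; constructor. Qed.

Lemma wp_assign x a c (Q : state -> Prop) s :
  Q (setr s x (eval s a)) -> (cost a).+1 <= c -> wp (Assign x a) c Q s.
Proof. by move=> q c0; exists (cost a).+1, (setr s x (eval s a)); split=> //; constructor. Qed.

Lemma wp_store a b c (Q : state -> Prop) s :
  Q (State (reg s) (update (mem_at s) (eval s a) (eval s b))) ->
  (cost a + cost b).+1 <= c -> wp (Store a b) c Q s.
Proof.
move=> q c0; exists (cost a + cost b).+1; eexists; split=> //; first constructor.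
exact: q.
Qed.

Lemma wp_seq p q c1 c2 c Q1 Q s :
  wp p c1 Q1 s -> (forall s1, Q1 s1 -> frame p s s1 -> wp q c2 Q s1) ->
  c1 + c2 < c -> wp (Seq p q) c Q s.
Proof.
case=> t1 [s1 [e1 tc1 q1]] h cc; case: (h _ q1 (exec_frame e1)) => t2 [s2 [e2 tc2 q2]].
exists (t1 + t2).+1, s2; split=> //; first exact: exec_seq e2.
by apply: leq_trans cc; rewrite ltnS leq_add.
Qed.

Lemma wp_if a p q c c' Q s :
  (eval s a != 0 -> wp p c Q s) -> (eval s a = 0 -> wp q c Q s) ->
  cost a + c < c' -> wp (If a p q) c' Q s.
Proof.
move=> h1 h2 cc; case: (eqVneq (eval s a) 0) => ea.
  case: (h2 ea) => t [s' [ex tc qq]]; exists (cost a + t).+1, s'; split=> //.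
    exact: exec_if_false.
  by apply: leq_trans cc; rewrite ltnS leq_add2l.
case: (h1 ea) => t [s' [ex tc qq]]; exists (cost a + t).+1, s'; split=> //.
  exact: exec_if_true.
by apply: leq_trans cc; rewrite ltnS leq_add2l.
Qed.

(* The invariant is indexed by a bound on the number of remaining iterations. *)
Lemma wp_while (I : nat -> state -> Prop) a p c b s :
  (forall b s, I b s -> eval s a != 0 ->
     exists2 b', b = b'.+1 & wp p c (I b') s) ->
  I b s ->
  wp (While a p) (b * (cost a + c).+1 + (cost a).+1)
     (fun s' => eval s' a = 0 /\ exists b', I b' s') s.
Proof.
move=> step; elim/ltn_ind: b s => b IH s Ib.
case: (eqVneq (eval s a) 0) => ea.
  exists (cost a).+1, s; split; [exact: exec_while_false | exact: leq_addl |].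
  by split=> //; exists b.
have [b' bb [t1 [s1 [e1 tc1 I1]]]] := step b s Ib ea; subst b.
case: (IH b' (ltnSn _) s1 I1) => t2 [s2 [e2 tc2 q2]].
exists (cost a + t1 + t2).+1, s2; split=> //; first exact: exec_while_true e2.
by rewrite mulSn; lia.
Qed.

(** The machine does not multiply; rows are reached by a counter that advances by the row length,
    hence the step [st]. *)
Definition loop i lo hi st body :=
  Seq (Assign i lo)
      (While (Sub hi (Reg i)) (Seq body (Assign i (Add (Reg i) st)))).

(** [K] is the number of iterations: the counter, started at [b0] and raised by [w], first fails to
    be below [h] after [K] of them. The body must establish the next invariant for the state in
    which the counter has already been raised. *)
Lemma wp_loop (I : nat -> state -> Prop) K b0 w h cb c i lo hi st body s :
  i \notin writes body ->
  eval s lo = b0 ->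
  (forall j, j <= K -> (b0 + j * w < h) = (j < K)) ->
  (forall s1, frame (loop i lo hi st body) s s1 -> eval s1 hi = h /\ eval s1 st = w) ->
  I 0 (setr s i b0) ->
  (forall j s1, j < K -> frame (loop i lo hi st body) s s1 ->
     reg s1 i = b0 + j * w -> I j s1 ->
     wp body cb (fun s2 => I j.+1 (setr s2 i (b0 + j.+1 * w))) s1) ->
  cost lo + K * (cb + cost hi + cost st + 7) + cost hi + 5 <= c ->
  wp (loop i lo hi st body) c (I K) s.
Proof.
move=> iw elo hK hev I0 step cc.
(* The frame relative to the initial state is carried along, so that [hi] and [st] keep their
   values. *)
pose J b s1 := exists j, [/\ b = K - j, j <= K, reg s1 i = b0 + j * w,
  I j s1 & frame (loop i lo hi st body) s s1].
have stepJ b s1 : J b s1 -> eval s1 (Sub hi (Reg i)) != 0 ->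
    exists2 b', b = b'.+1 &
      wp (Seq body (Assign i (Add (Reg i) st))) (cb + cost st + 4) (J b') s1.
  case=> j [-> jK ri Ij fr]; have [eh es] := hev _ fr.
  rewrite /= eh ri subn_eq0 -ltnNge hK // => jlt.
  exists (K - j.+1); first by lia.
  apply: (wp_seq (c2 := cost st + 3) (step j s1 jlt fr ri Ij)); last by lia.
  move=> s2 I2 fr2; apply: wp_assign; last by rewrite /=; lia.
  have fr3 : frame (loop i lo hi st body) s s2.
    case: fr fr2 => [f1 f2] [g1 g2]; split=> /= [x|hn].
      rewrite inE mem_cat inE !negb_or => /and3P[xi xb _].
      by rewrite g1 // f1 //= in_cons mem_cat mem_seq1 !negb_or xi xb.
    by rewrite g2 ?f2 //=; rewrite andbT in hn; rewrite ?hn.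
  have [eh2 es2] := hev _ fr3.
  have v : eval s2 (Add (Reg i) st) = b0 + j.+1 * w.
    by rewrite /= es2 fr2.1 // ri mulSn; lia.
  exists j.+1; split=> //; first by rewrite /= /update eqxx -v.
    by rewrite v.
  case: fr3 => [f1 f2]; split=> //= x xw; rewrite -f1 // /update.
  by case: eqP => // xi; move: xw; rewrite xi /= inE eqxx.
have st1 : wp (Assign i lo) (cost lo).+1 (J K) s.
  apply: wp_assign => //; exists 0; rewrite elo subn0; split=> //.
    by rewrite /= /update eqxx mul0n addn0.
  split=> //= x; rewrite inE negb_or /update => /andP[/negbTE-> _]; exact: erefl.
apply: wp_seq st1 _ _.
  move=> s1 J1 _; apply: wp_conseq (wp_while stepJ J1) (leqnn _) _.
  move=> s2 [e0 [b [j [_ jK ri Ij fr]]]] _.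
  have [eh es] := hev _ fr; move: e0; rewrite /= eh ri => /eqP.
  by rewrite subn_eq0 leqNgt hK // -leqNgt => Kj; rewrite (_ : K = j) //; lia.
rewrite /= -/addn in cc *; apply: leq_trans cc.
have -> : (cost hi + 1).+1 + (cb + cost st + 4) = cb + cost hi + cost st + 6 by lia.
by move: (K * _) (leq_mul2l K (cb + cost hi + cost st + 6).+1 (cb + cost hi + cost st + 7)); lia.
Qed.

Arguments update f a v b /.

Definition cols body := loop 5 (Lit 0) (Reg 0) (Lit 1) body.

Lemma wp_cols (I : nat -> state -> Prop) n cb c body s :
  reg s 0 = n -> 5 \notin writes body -> 0 \notin writes body ->
  I 0 (setr s 5 0) ->
  (forall j s1, j < n -> frame (cols body) s s1 -> reg s1 5 = j -> I j s1 ->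
     wp body cb (fun s2 => I j.+1 (setr s2 5 j.+1)) s1) ->
  n * (cb + 9) + 7 <= c ->
  wp (cols body) c (I n) s.
Proof.
move=> rn w5 w0 I0 step cc.
apply: (@wp_loop I n 0 1 n cb) => //.
- by move=> j _; rewrite muln1.
- move=> s1 [fr _]; split=> //=; rewrite fr //=.
  by rewrite inE mem_cat inE (negbTE w0).
- move=> j s1 jn fr r5 Ij; rewrite add0n muln1 in r5; rewrite add0n muln1.
  exact: step.
- by rewrite /=; move: cc; rewrite -!addnA; lia.
Qed.

Definition rowloop p lo hi body := loop p lo hi (Reg 0) body.

Lemma wp_rowloop (I : nat -> state -> Prop) n A B cb c p lo hi body s :
  0 < n -> A <= B ->
  reg s 0 = n -> p \notin writes body -> 0 \notin p :: writes body ->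
  eval s lo = A * n ->
  (forall s1, frame (rowloop p lo hi body) s s1 -> eval s1 hi = B * n) ->
  I A (setr s p (A * n)) ->
  (forall j s1, A <= j -> j < B -> frame (rowloop p lo hi body) s s1 ->
     reg s1 p = j * n -> I j s1 ->
     wp body cb (fun s2 => I j.+1 (setr s2 p (j.+1 * n))) s1) ->
  cost lo + (B - A) * (cb + cost hi + 8) + cost hi + 5 <= c ->
  wp (rowloop p lo hi body) c (I B) s.
Proof.
move=> n0 AB rn wp' w0 elo ehi I0 step cc.
rewrite (_ : I B = (fun i => I (A + i)) (B - A)); last by rewrite /= subnKC.
apply: (@wp_loop (fun i => I (A + i)) (B - A) (A * n) n (B * n) cb) => //.
- by move=> j jB; rewrite -mulnDl ltn_pmul2r //; lia.
- move=> s1 fr; split; first exact: ehi.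
  rewrite /= fr.1 //=; move: w0; rewrite !in_cons mem_cat mem_seq1 !negb_or.
  by case/andP=> -> ->.
- by rewrite addn0.
- move=> j s1 jB fr rp Ij; rewrite -mulnDl in rp; rewrite addnS -mulnDl addnS.
  by apply: step => //; lia.
- by rewrite /= (_ : cb + _ + 1 + 7 = cb + cost hi + 8) //; lia.
Qed.

(** * Rows as sets, and their comparison *)

Definition row n (M : nat -> nat) a : {set 'I_n} := [set j : 'I_n | M (a + j) != 0].

(** Unlike a quantifier over ordinals it can be extended by one index ([all_belowS]), as a flag kept
    by a loop is. *)
Definition all_below (P : pred nat) n := all P (iota 0 n).
Arguments all_below : simpl never.

Lemma allP_ord n (P : pred nat) : reflect (forall j : 'I_n, P j) (all_below P n).
Proof.
apply: (iffP allP) => [h j | h j]; first by apply: h; rewrite mem_iota ltn_ord.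
by rewrite mem_iota => jn; apply: (h (Ordinal jn)).
Qed.

Lemma row_subset n M x y : (row n M x \subset row n M y)
  = all_below (fun j => (M (x + j) != 0) ==> (M (y + j) != 0)) n.
Proof.
apply/subsetP/allP_ord => [h j | h j]; have := h j; rewrite !inE.
  by move/implyP.
by move/implyP.
Qed.

Lemma all_belowS (P : pred nat) n : all_below P n.+1 = all_below P n && P n.
Proof. by rewrite /all_below -addn1 iotaD all_cat /= andbT. Qed.

Definition subset_rows a b :=
  Seq (Assign 6 (Lit 1))
    (cols (If (Mem (Add (Reg a) (Reg 5)))
             (If (Mem (Add (Reg b) (Reg 5))) Skip (Assign 6 (Lit 0))) Skip)).

(** A pair instead of a conjunction, so that [rewrite] takes it as a multi-rule. *)
Lemma notin56 a : a \notin [:: 5; 6] -> (a == 5 = false) * (a == 6 = false).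
Proof. by rewrite !inE negb_or => /andP[/negbTE-> /negbTE->]. Qed.

Lemma wp_subset_rows n a b x y s :
  reg s 0 = n -> 0 < n -> a \notin [:: 5; 6] -> b \notin [:: 5; 6] ->
  reg s a = x -> reg s b = y ->
  wp (subset_rows a b) (40 * n)
     (fun s' => reg s' 6 = (row n (mem_at s) x \subset row n (mem_at s) y)) s.
Proof.
move=> rn n0 a56 b56 ra rb; set M := mem_at s.
pose P j := (M (x + j) != 0) ==> (M (y + j) != 0).
apply: (@wp_seq _ _ 2 (30 * n) _ (fun s1 => s1 = setr s 6 1)); last by lia.
  by apply: wp_assign.
move=> _ -> _; rewrite row_subset -/P.
apply: (@wp_cols (fun j s1 => reg s1 6 = all_below P j) n 12) => //; last by lia.
move=> j s1 jn [fr fm] r5 r6.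
have ra1 : reg s1 a = x.
  by rewrite fr /= ?(notin56 a56) // !inE !(notin56 a56).
have rb1 : reg s1 b = y.
  by rewrite fr /= ?(notin56 b56) // !inE !(notin56 b56).
have fm1 : mem_at s1 = M by rewrite fm.
apply: (@wp_if _ _ _ 7) => /=; rewrite ?ra1 ?r5 ?fm1 // => h1.
  apply: (@wp_if _ _ _ 2) => /=; rewrite ?rb1 ?r5 ?fm1 // => h2.
    by apply: wp_skip => //; rewrite all_belowS /= r6 /P h2 implybT andbT.
  by apply: wp_assign => //; rewrite all_belowS /= /P h1 h2 andbF.
by apply: wp_skip => //; rewrite all_belowS /= r6 /P h1 andbT.
Qed.

Definition eq_rows a b := Seq (subset_rows a b) (If (Reg 6) (subset_rows b a) Skip).

Lemma wp_eq_rows n a b x y s :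
  reg s 0 = n -> 0 < n -> a \notin [:: 5; 6] -> b \notin [:: 5; 6] ->
  reg s a = x -> reg s b = y ->
  wp (eq_rows a b) (90 * n)
     (fun s' => reg s' 6 = (row n (mem_at s) x == row n (mem_at s) y)) s.
Proof.
move=> rn n0 a56 b56 ra rb.
apply: (wp_seq (c2 := 40 * n + 3) (wp_subset_rows rn n0 a56 b56 ra rb)); last by lia.
move=> s1 r6 [fr fm]; apply: (@wp_if _ _ _ (40 * n)) => /=; rewrite ?r6 ?fm //.
- move=> h; rewrite eqEsubset; move: h; case: (_ \subset _) => // _.
  rewrite -fm //; apply: wp_subset_rows => //; rewrite fr //= !inE.
    by rewrite !(notin56 b56).
  by rewrite !(notin56 a56).
- move=> h; apply: wp_skip; last by lia.
  by rewrite r6 eqEsubset h; case: (_ \subset _) h.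
- by lia.
Qed.

Definition proper_rows a b :=
  Seq (subset_rows a b)
    (If (Reg 6) (Seq (subset_rows b a) (Assign 6 (Sub (Lit 1) (Reg 6)))) Skip).

Lemma wp_proper_rows n a b x y s :
  reg s 0 = n -> 0 < n -> a \notin [:: 5; 6] -> b \notin [:: 5; 6] ->
  reg s a = x -> reg s b = y ->
  wp (proper_rows a b) (90 * n)
     (fun s' => reg s' 6 = (row n (mem_at s) x \proper row n (mem_at s) y)) s.
Proof.
move=> rn n0 a56 b56 ra rb.
apply: (@wp_seq _ _ (40 * n) (40 * n + 9) _ _ _ s (wp_subset_rows rn n0 a56 b56 ra rb)).
  move=> s1 r6 [fr fm]; apply: (@wp_if _ _ _ (40 * n + 7)) => /=; rewrite ?r6 ?fm //.
  - move=> h; rewrite properE; move: h; case: (_ \subset _) => // _.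
    have h : wp (subset_rows b a) (40 * n) (fun s' => reg s' 6 =
        (row n (mem_at s) y \subset row n (mem_at s) x)) s1.
      rewrite -fm //; apply: wp_subset_rows => //; rewrite fr //= !inE.
        by rewrite !(notin56 b56).
      by rewrite !(notin56 a56).
    apply: (wp_seq (c2 := 4) h); last by lia.
    move=> s2 r62 _; apply: wp_assign => //=; rewrite r62.
    by case: (_ \subset _).
  - move=> h; apply: wp_skip; last by lia.
    by rewrite r6 properE h; case: (_ \subset _) h.
  - by lia.
by lia.
Qed.

(** The step is told the exact contents of the partly rewritten row: cells not yet reached hold
    their old values, so [new] may be computed from them and rows can be changed in place. *)
Lemma wp_mapcols n cb c body base (new : nat -> nat) s :
  reg s 0 = n -> 5 \notin writes body -> 0 \notin writes body ->
  (forall j s1, j < n -> frame (cols body) s s1 -> reg s1 5 = j ->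
     (forall a, mem_at s1 a =
        if base <= a < base + j then new (a - base) else mem_at s a) ->
     wp body cb (fun s2 => forall a, mem_at s2 a =
        if a == base + j then new j else mem_at s1 a) s1) ->
  n * (cb + 9) + 7 <= c ->
  wp (cols body) c (fun s' => forall a, mem_at s' a =
        if base <= a < base + n then new (a - base) else mem_at s a) s.
Proof.
move=> rn w5 w0 step cc.
apply: (@wp_cols (fun j s1 => forall a, mem_at s1 a =
        if base <= a < base + j then new (a - base) else mem_at s a) n cb) => //.
  by move=> a /=; rewrite addn0 ltnNge; case: ifP => // /andP[->].
move=> j s1 jn fr r5 Ij; apply: wp_conseq (step j s1 jn fr r5 Ij) (leqnn _) _.
move=> s2 m2 _ a /=; rewrite m2 Ij; case: eqP => [->|ne].
  by rewrite leq_addr addnS ltnS leqnn addKn.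
by rewrite (_ : (base <= a < base + j.+1) = (base <= a < base + j)) //; lia.
Qed.

Lemma row_ext n M M' a : (forall j, j < n -> M' (a + j) = M (a + j)) ->
  row n M' a = row n M a.
Proof. by move=> h; apply/setP => j; rewrite !inE h. Qed.

Lemma row_outside n (M M' new : nat -> nat) p i :
  (forall a, M' a = if p * n <= a < p * n + n then new (a - p * n) else M a) ->
  i != p -> row n M' (i * n) = row n M (i * n).
Proof.
move=> h ip; apply: row_ext => j jn; rewrite h.
case: ifP => // /andP[h1 h2]; case/negP: ip; rewrite eqn_leq.
have p1 : p * n < i.+1 * n by rewrite mulSn; lia.
have p2 : i * n < p.+1 * n by rewrite mulSn; lia.
have n0 : 0 < n by lia.
by rewrite !ltn_pmul2r // !ltnS in p1 p2; rewrite p1 p2.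
Qed.

Lemma row_inside n (M M' new : nat -> nat) a :
  (forall b, M' b = if a <= b < a + n then new (b - a) else M b) ->
  row n M' a = [set j : 'I_n | new j != 0].
Proof.
move=> h; apply/setP => j; rewrite !inE h leq_addr ltn_add2l ltn_ord /=.
by rewrite addKn.
Qed.

Definition rowi n M i : {set 'I_n} := row n M (i * n).

(** * The kernelization program *)

Lemma nat_of_bool_neq0 (b : bool) : (b : nat) != 0 -> b. Proof. by case: b. Qed.

Lemma nat_of_bool_eq0 (b : bool) : (b : nat) = 0 -> ~~ b. Proof. by case: b. Qed.

(* Registers: 0 to 2 hold n, m, k; 3 the address after the last row; 4 the
   address m * n; 5 the column; 6 the result of a row comparison; 7 and 9 row
   addresses; 8 an element; 10 a flag. During the search: 11 the level t, 12 the
   bound k^(t-1), 13 whether an edge to group was found, 14 whether to go on, 15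
   a cardinality or the column that represents the new vertex, 16 the address of
   the edge to group. When the result is written out: 16 the output address, 17
   the number of edges. *)
Definition init :=
  Seq (Assign 4 (Lit 0))
  (Seq (loop 5 (Lit 0) (Reg 1) (Lit 1) (Assign 4 (Add (Reg 4) (Reg 0))))
  (Seq (cols (Store (Add (Add (Reg 4) (Reg 0)) (Reg 5)) (Lit 1)))
       (Assign 3 (Add (Add (Reg 4) (Reg 0)) (Reg 0))))).

Lemma wp_init n m s : reg s 0 = n -> reg s 1 = m -> 0 < n ->
  wp init (90 * (m + n)) (fun s' =>
    [/\ reg s' 3 = (m + 2) * n, reg s' 4 = m * n &
        forall a, mem_at s' a =
          if m.+1 * n <= a < m.+1 * n + n then 1 else mem_at s a]) s.
Proof.
move=> rn rm n0; rewrite /init.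
apply: (@wp_seq _ _ 2 (30 * (m + n) + 50) _ (fun s1 => s1 = setr s 4 0)); last by lia.
  by apply: wp_assign.
move=> _ -> _; set s1 := setr s 4 0.
apply: (@wp_seq _ _ (13 * m + 7) (30 * n + 7) _ (fun s1 => reg s1 4 = m * n)); last by lia.
  apply: (@wp_loop (fun j s1 => reg s1 4 = j * n) m 0 1 m 4) => //=.
  - by move=> j _; rewrite muln1.
  - by move=> s2 [fr _]; rewrite fr.
  - move=> j s2 jm [fr _] _ r4; apply: wp_assign => //=.
    by rewrite r4 fr //= rn mulSn addnC.
  - by lia.
move=> s2 r4 [fr fm].
apply: (@wp_seq _ _ (16 * n + 7) 6 _ (fun s3 => forall a, mem_at s3 a =
    if m.+1 * n <= a < m.+1 * n + n then 1 else mem_at s2 a)); last by lia.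
  apply: (@wp_mapcols n 7 _ _ (m.+1 * n) (fun=> 1)) => //; first by rewrite fr.
    move=> j s3 jn [fr3 _] r5 _; apply: wp_store => //= a.
    by rewrite r5 !fr3 //= r4 fr //= rn mulSn [m * n + n]addnC.
  by lia.
move=> s3 m3 [fr3 _]; apply: wp_assign => //=; split.
- by rewrite !fr3 //= r4 fr //= rn mulnDl; lia.
- by rewrite fr3.
- by move=> a; rewrite m3 fm.
Qed.

(** * Listing the closed sets *)

Definition succ_row :=
  Seq (cols (Store (Add (Reg 3) (Reg 5)) (Lit 1)))
    (rowloop 9 (Lit 0) (Reg 4)
       (If (Mem (Add (Reg 9) (Reg 8)))
          (Seq (subset_rows 7 9)
             (If (Reg 6)
                (cols (If (Mem (Add (Reg 9) (Reg 5))) Skip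
                         (Store (Add (Reg 3) (Reg 5)) (Lit 0))))
                Skip))
          Skip)).

(** Row [N] is the first free one and serves as scratch: it joins the list only if [append_row]
    finds no equal row. It starts as all ones, the intersection of no edges. *)
Lemma wp_succ_row n m N p (x : 'I_n) s : 0 < n -> m <= N -> p < N ->
  reg s 0 = n -> reg s 3 = N * n -> reg s 4 = m * n -> reg s 7 = p * n ->
  reg s 8 = x ->
  let R := rowi n (mem_at s) in
  wp succ_row (150 * n * m.+1) (fun s' =>
    (forall i, i != N -> rowi n (mem_at s') i = R i) /\
    rowi n (mem_at s') N =
      \bigcap_(0 <= i < m | (R p \subset R i) && (x \in R i)) R i) s.
Proof.
move=> n0 mN pN rn r3 r4 r7 r8 R.
pose Q j s1 := (forall i, i != N -> rowi n (mem_at s1) i = R i) /\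
    rowi n (mem_at s1) N =
      \bigcap_(0 <= i < j | (R p \subset R i) && (x \in R i)) R i.
apply: (@wp_seq _ _ (15 * n + 7) (m * (80 * n + 9) + 7) _ (Q 0)); last by nia.
  apply: wp_conseq (@wp_mapcols n 6 (15 * n + 7) _ (N * n) (fun=> 1) s _ _ _ _ _) _ _ => //.
  - move=> j s1 jn [fr _] r5 _; apply: wp_store => //= a.
    by rewrite r5 !fr //= r3.
  - by lia.
  - move=> s1 h _; split=> [i iN|]; first exact: (row_outside (new := fun=> 1) h iN).
    rewrite big_geq // /rowi (row_inside (new := fun=> 1) h).
    by apply/setP => j; rewrite !inE.
move=> s1 Q1 [fr _].
apply: (@wp_rowloop Q n 0 m (80 * n)) => //=.
- by rewrite fr.
- by move=> s2 [fr2 _]; rewrite fr2 //= fr.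
- move=> j s2 _ jm [fr2 _] r9 [out in_].
  have [rn2 r32 r72 r82] : [/\ reg s2 0 = n, reg s2 3 = N * n, reg s2 7 = p * n & reg s2 8 = x].
    by rewrite !fr2 //= !fr.
  have jN : j != N by lia.
  have Rj : rowi n (mem_at s2) j = R j by apply: out.
  have Rp : rowi n (mem_at s2) p = R p by apply: out; lia.
  have xR : (mem_at s2 (j * n + x) != 0) = (x \in R j) by rewrite -Rj inE.
  have QS : ~~ ((R p \subset R j) && (x \in R j)) -> forall s3, mem_at s3 = mem_at s2 ->
      Q j.+1 s3.
    move=> h s3 ms; rewrite /Q ms; split=> //.
    by rewrite in_ [in RHS]big_mkcond big_nat_recr //= (negbTE h) setIT -big_mkcond.
  apply: (@wp_if _ _ _ (75 * n)) => /=; rewrite ?r9 ?r82 ?xR.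
  + move=> xj; rewrite xj andbT in QS.
    apply: (wp_seq (c2 := 32 * n) (@wp_subset_rows n 7 9 _ _ s2 rn2 n0 isT isT r72 r9)); last by lia.
    move=> s3; rewrite -!/(rowi _ _ _) Rj Rp => r6 [fr3 fm3].
    apply: (@wp_if _ _ _ (30 * n)) => /=; rewrite ?r6; last by lia.
      move=> sub.
      pose nw i := if mem_at s2 (j * n + i) != 0 then mem_at s2 (N * n + i) else 0.
      apply: wp_conseq (@wp_mapcols n 10 (30 * n) _ (N * n) nw s3 _ _ _ _ _) _ _ => //.
      * by rewrite fr3.
      * move=> i s4 iltn [fr4 _] r5 m4.
        have e1 : mem_at s4 (j * n + i) = mem_at s2 (j * n + i).
          rewrite m4 fm3 //; case: ifP => // /andP[h1 h2].
          have : j * n + n <= N * n by rewrite addnC -mulSn leq_mul2r; lia.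
          by lia.
        apply: (@wp_if _ _ _ 5) => //=; rewrite r5 !fr4 //= !fr3 //= r9 e1 => h.
          apply: wp_skip => // a; case: eqP => // ->; rewrite /nw h m4 fm3 //.
          by case: ifP => //; lia.
        by apply: wp_store => //= a; rewrite r5 !fr4 //= !fr3 //= r32 /nw h.
      * by lia.
      move=> s4 h4 _; split=> [i iN | ].
        by rewrite /= /rowi (row_outside (new := nw) h4 iN) fm3 // -/(rowi _ _ _) out.
      rewrite big_mkcond big_nat_recr //= -big_mkcond xj andbT.
      have -> : R p \subset R j by apply: nat_of_bool_neq0 sub.
      rewrite -in_ -Rj {1}/rowi (row_inside (new := nw) h4); apply/setP => i; rewrite !inE.
      by rewrite /nw; case: (mem_at s2 (j * n + i) != 0); rewrite ?andbT ?andbF.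
    move=> nsub; apply: wp_skip; last by lia.
    by apply: QS; [apply: nat_of_bool_eq0 nsub | rewrite /= fm3].
  + move=> nx; apply: wp_skip; last by lia.
    by apply: QS => //; rewrite -xR nx eqxx andbF.
  + by lia.
- by lia.
Qed.

Definition append_row :=
  Seq (Assign 10 (Lit 1))
    (Seq (rowloop 9 (Lit 0) (Reg 3)
            (Seq (eq_rows 9 3) (If (Reg 6) (Assign 10 (Lit 0)) Skip)))
       (If (Reg 10) (Assign 3 (Add (Reg 3) (Reg 0))) Skip)).

Lemma wp_append_row n N s : 0 < n -> reg s 0 = n -> reg s 3 = N * n ->
  let R := rowi n (mem_at s) in
  wp append_row (130 * n * N.+1) (fun s' => mem_at s' = mem_at s /\
    if all_below (fun i => R i != R N) N then reg s' 3 = N.+1 * n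
    else reg s' 3 = N * n) s.
Proof.
move=> n0 rn r3 R.
apply: (@wp_seq _ _ 2 (120 * n * N + 20) _ (fun s1 => s1 = setr s 10 1)); last by nia.
  by apply: wp_assign.
move=> _ -> _.
apply: (@wp_seq _ _ (120 * n * N + 10) 7 _ (fun s1 => mem_at s1 = mem_at s /\
   reg s1 10 = all_below (fun i => R i != R N) N)); last by lia.
  apply: (@wp_rowloop (fun j s1 => mem_at s1 = mem_at s /\
   reg s1 10 = all_below (fun i => R i != R N) j) n 0 N (90 * n + 10)) => //=.
  - by move=> s1 [fr _]; rewrite fr.
  - move=> j s1 _ jN [fr _] r9 [ms r10].
    have [rn1 r31] : reg s1 0 = n /\ reg s1 3 = N * n by rewrite !fr.
    apply: (wp_seq (c2 := 4) (@wp_eq_rows n 9 3 _ _ s1 rn1 n0 isT isT r9 r31)); last by lia.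
    move=> s2; rewrite ms -!/(rowi _ _ _) -/(R j) -/(R N) => r6 [fr2 fm2].
    apply: (@wp_if _ _ _ 2) => //=; rewrite r6 => h.
      apply: wp_assign => //=; split; first by rewrite fm2.
      by rewrite all_belowS (nat_of_bool_neq0 h) andbF.
    apply: wp_skip => //=; split; first by rewrite fm2.
    by rewrite fr2 //= all_belowS (nat_of_bool_eq0 h) andbT.
  - by nia.
move=> s1 [ms r10] [fr _].
apply: (@wp_if _ _ _ 4) => //=; rewrite r10 => h.
  apply: wp_assign => //=; split=> //; rewrite (nat_of_bool_neq0 h) !fr //= r3 rn.
  by rewrite mulSn addnC.
apply: wp_skip => //=; split=> //; rewrite (negbTE (nat_of_bool_eq0 h)) fr //=.
Qed.

Section ClosingList.

Variables (n m : nat) (R0 : nat -> {set 'I_n}).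

Definition edge_rows : {set {set 'I_n}} := [set R0 i | i : 'I_m].

Lemma cl_edge_rows (A : {set 'I_n}) x :
  cl edge_rows (x |: A) = \bigcap_(0 <= i < m | (A \subset R0 i) && (x \in R0 i)) R0 i.
Proof.
rewrite big_mkord; apply/setP => y; apply/bigcapP/bigcapP => h i hi.
  by apply: h; rewrite subUset sub1set [X in _ && X]andbC hi andbT; apply/imsetP; exists i.
case/andP: hi => /imsetP[j _ ->]; rewrite subUset sub1set andbC => hj.
exact: h.
Qed.

(* Rows m and m.+1 hold the empty and the full set, rows from m.+2 on are the
   pairwise distinct closed sets found so far; the successors of the first p
   rows, and those of row p by elements below x, are listed. *)
Definition closing (R : nat -> {set 'I_n}) N p x :=
  [/\ m.+2 <= N, forall i, i < m.+2 -> R i = R0 i,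
      {subset [seq R i | i <- iota m.+2 (N - m.+2)] <= intersection_closure edge_rows},
      uniq [seq R i | i <- iota m.+2 (N - m.+2)] &
      forall i (y : 'I_n), i < N -> (i < p) || ((i == p) && (y < x)) ->
        exists2 j, j < N & R j = cl edge_rows (y |: R i)].

(** The outer loop runs over a list that grows meanwhile; this bound on the length at any moment
    bounds its iterations. *)
Lemma closing_size R N p x : closing R N p x ->
  N <= m.+2 + #|intersection_closure edge_rows|.
Proof.
case=> mN _ sub u _; have : size [seq R i | i <- iota m.+2 (N - m.+2)] <= #|intersection_closure edge_rows|.
  by rewrite cardE; apply: uniq_leq_size => // a /sub; rewrite mem_enum.
by rewrite size_map size_iota; lia.
Qed.

Lemma closing_step R R' N p (x : 'I_n) : p < N -> closing R N p x ->
  (forall i, i < N -> R' i = R i) ->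
  R' N = cl edge_rows (x |: R p) ->
  closing R' (if all_below (fun i => R' i != R' N) N then N.+1 else N) p x.+1.
Proof.
move=> pN [mN R0E sub u suc] R'E R'N.
have old : [seq R' i | i <- iota m.+2 (N - m.+2)] = [seq R i | i <- iota m.+2 (N - m.+2)].
  by apply/eq_in_map => i; rewrite mem_iota => /andP[h1 h2]; apply: R'E; lia.
case: ifP => new.
  have eN : N.+1 - m.+2 = (N - m.+2) + 1 by lia.
  split; rewrite ?eN.
  - by lia.
  - by move=> i im; rewrite R'E ?R0E //; lia.
  - rewrite iotaD map_cat old subnKC // => a; rewrite mem_cat => /orP[/sub //|].
    by rewrite /= inE => /eqP->; rewrite R'N cl_closure.
  - rewrite iotaD map_cat old subnKC // cat_uniq u /= orbF andbT.
    rewrite -old; apply/mapP => -[i]; rewrite mem_iota => /andP[h1 h2] RN.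
    have iN : i < N by lia.
    by move/allP_ord: new => /(_ (Ordinal iN)); rewrite /= RN eqxx.
  - move=> i y; rewrite ltnS leq_eqVlt => /orP[/eqP-> | iN].
      by rewrite ltnNge ltnW //= (gtn_eqF pN).
    rewrite R'E // => h; case: (boolP ((i < p) || (i == p) && (y < x))) => [h1|h1].
      by have [j jN Rj] := suc i y iN h1; exists j; [exact: ltnW | rewrite R'E].
    have [ip yx] : i = p /\ y = x.
      have [ip yx] : i = p /\ y < x.+1.
        by case/orP: h h1 => [->//|/andP[/eqP->]]; rewrite eqxx ltnn.
      by split=> //; apply: val_inj => /=; move: h1; rewrite ip eqxx ltnn /=; lia.
    by exists N; rewrite // ip yx.
split=> //.
- by move=> i im; rewrite R'E ?R0E //; lia.
- by rewrite old.
- by rewrite old.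
move=> i y iN h; rewrite R'E //.
case: (boolP ((i < p) || (i == p) && (y < x))) => [h1|h1].
  by have [j jN Rj] := suc i y iN h1; exists j; rewrite // R'E.
have [ip yx] : i = p /\ y = x.
  have [ip yx] : i = p /\ y < x.+1.
    by case/orP: h h1 => [->//|/andP[/eqP->]]; rewrite eqxx ltnn.
  by split=> //; apply: val_inj => /=; move: h1; rewrite ip eqxx ltnn /=; lia.
(* The row was discarded because an earlier one equals it, and that one is the successor sought. *)
move/negbT: new; rewrite /all_below => /allPn[j]; rewrite mem_iota negbK => jN /eqP Rj.
by exists j; rewrite ?Rj ?R'N ?ip ?yx //; lia.
Qed.

(** Given a closed e, take a largest listed set inside e; there is one, as the empty set is listed.
    If it missed some x in e, its successor by x would be listed, inside e and larger. *)
Lemma closing_done R N : closing R N N 0 ->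
  R0 m = set0 -> R0 m.+1 = setT -> set0 \in intersection_closure edge_rows ->
  [set R i | i : 'I_N] = intersection_closure edge_rows.
Proof.
move=> [mN R0E sub u suc] Rm Rm1 E0; apply/eqP; rewrite eqEsubset; apply/andP; split.
  apply/subsetP => _ /imsetP[i _ ->].
  case: (leqP m.+2 i) => [mi|im].
    by apply: sub; apply: map_f; rewrite mem_iota mi subnKC /=.
  rewrite R0E //; case: (ltnP i m) => [im'|].
    by apply: (subsetP (sub_closure _)); apply/imsetP; exists (Ordinal im').
  move: im; rewrite ltnS leq_eqVlt ltnS => /orP[/eqP->|im mi]; first by rewrite Rm1 closureT.
  by have -> : nat_of_ord i = m by [lia]; rewrite Rm.
apply/subsetP => e eE.
have m_lt : m < N by lia.
pose P (i : 'I_N) := R i \subset e.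
have P0 : P (Ordinal m_lt) by rewrite /P /= R0E // Rm sub0set.
case: (arg_maxnP (fun i : 'I_N => #|R i|) P0) => i Pi imax.
apply/imsetP; exists i => //; apply/eqP; rewrite eq_sym eqEsubset -[R i \subset e]/(P i) Pi.
apply/subsetP => x xe; apply: contraT => xi.
have [|j jN Rj] := suc i x (ltn_ord i); first by rewrite ltn_ord.
have : #|R j| <= #|R i|.
  by apply: (imax (Ordinal jN)); rewrite /P /= Rj; apply: cl_min; rewrite // subUset sub1set xe.
rewrite leqNgt Rj => /negP[]; apply: proper_card; apply/properP; split.
  exact: subset_trans (subsetUr _ _) (sub_cl _ _).
by exists x => //; apply: (subsetP (sub_cl _ _)); rewrite setU11.
Qed.

End ClosingList.

Definition close_rows :=
  Seq (Assign 7 (Lit 0))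
    (While (Sub (Reg 3) (Reg 7))
       (Seq (loop 8 (Lit 0) (Reg 0) (Lit 1) (Seq succ_row append_row))
            (Assign 7 (Add (Reg 7) (Reg 0))))).

Lemma wp_close_rows n m s : 0 < n ->
  reg s 0 = n -> reg s 3 = m.+2 * n -> reg s 4 = m * n ->
  let R0 := rowi n (mem_at s) in
  let E' := intersection_closure (edge_rows m R0) in
  let NN := (m.+2 + #|E'|).+1 in
  R0 m = set0 -> R0 m.+1 = setT -> set0 \in E' ->
  wp close_rows (500 * (n * NN) ^ 2) (fun s' => exists N,
    [/\ reg s' 3 = N * n, m.+2 <= N < NN,
        forall i, i < m.+2 -> rowi n (mem_at s') i = R0 i &
        [set rowi n (mem_at s') i | i : 'I_N] = E']) s.
Proof.
move=> n0 rn r3 r4 R0 E' NN Rm Rm1 E0.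
pose inv p x s1 N := [/\ reg s1 0 = n, reg s1 3 = N * n, reg s1 4 = m * n,
  p <= N & closing m R0 (rowi n (mem_at s1)) N p x].
have invN p x s1 N : inv p x s1 N -> N < NN.
  by case=> _ _ _ _ /closing_size.
(* One pair of a row and an element costs 150 n (m+1) for the successor and 130 n (N+1) for the
   comparison with the list. *)
pose c1 := 300 * n * NN.
pose I b s1 := exists p N, [/\ b = NN - p, reg s1 7 = p * n & inv p 0 s1 N].
have step b s1 : I b s1 -> eval s1 (Sub (Reg 3) (Reg 7)) != 0 ->
    exists2 b', b = b'.+1 &
      wp (Seq (loop 8 (Lit 0) (Reg 0) (Lit 1) (Seq succ_row append_row))
            (Assign 7 (Add (Reg 7) (Reg 0)))) (n * (c1 + 9) + 20) (I b') s1.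
  case=> p [N [-> r7 iv]] /=; have NNN := invN _ _ _ _ iv.
  case: iv => rn1 r31 r41 pN clo; rewrite r31 r7 subn_eq0 -ltnNge ltn_pmul2r // => pltN.
  exists (NN - p.+1); first by lia.
  apply: (@wp_seq _ _ (n * (c1 + 9) + 8) 5 _
    (fun s2 => exists N2, p < N2 /\ inv p n s2 N2)); last by lia.
    apply: (@wp_loop (fun x s2 => exists N2, p < N2 /\ inv p x s2 N2) n 0 1 n c1) => //.
    - by move=> j _; rewrite muln1.
    - by move=> s2 [fr _]; rewrite /= fr.
    - by exists N.
    - move=> x s2 xn [fr _] r8 [N2 [pN2 iv2]]; have N2N := invN _ _ _ _ iv2.
      case: iv2 => rn2 r32 r42 pN2' clo2.
      have r72 : reg s2 7 = p * n by rewrite fr.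
      have mN : m <= N2 by case: clo2; lia.
      have r8' : reg s2 8 = Ordinal xn by rewrite r8 muln1.
      apply: (wp_seq (c2 := 130 * n * N2.+1)
        (wp_succ_row n0 mN pN2 rn2 r32 r42 r72 r8')); last by rewrite /c1; nia.
      move=> s3 [out in_] [fr3 _].
      have [rn3 r33] : reg s3 0 = n /\ reg s3 3 = N2 * n by rewrite !fr3.
      apply: wp_conseq (wp_append_row n0 rn3 r33) (leqnn _) _.
      move=> s4 [ms h] [fr4 _].
      have R3 : rowi n (mem_at s3) N2 = cl (edge_rows m R0) (Ordinal xn |: rowi n (mem_at s2) p).
        have RE i : i < m -> rowi n (mem_at s2) i = R0 i.
          by case: clo2 => _ RE _ _ _ im; rewrite RE //; lia.
        rewrite in_ cl_edge_rows big_nat_cond [RHS]big_nat_cond.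
        apply: eq_big => i; first by case im : (_ <= i < m); rewrite //= (RE i).
        by case/andP=> im _; rewrite RE.
      have := closing_step (x := Ordinal xn) pN2 clo2 (fun i iN => out i (negbT (ltn_eqF iN))) R3.
      case: ifP h => _ r34 clo4; [exists N2.+1 | exists N2].
        split; first exact: leqW.
        by rewrite /inv /= ms r34 !fr4 //= !fr3 //=; split=> //; rewrite ltnW // leqW.
      split=> //; rewrite /inv /= ms r34 !fr4 //= !fr3 //=; split=> //.
    - by rewrite /= (_ : c1 + 1 + 1 + 7 = c1 + 9); lia.
  move=> s2 [N2 [pN2 iv2]] [fr2 _]; apply: wp_assign => //=.
  case: iv2 => rn2 r32 r42 pN2' clo2.
  exists p.+1, N2; split=> //=.
    by rewrite fr2 //= r7 rn2 mulSn addnC.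
  split=> //=; case: clo2 => h1 h2 h3 h4 h5; split=> // i y iN; rewrite ltn0 andbF orbF ltnS leq_eqVlt.
  by move=> h; apply: h5; rewrite // ltn_ord andbT orbC.
apply: (@wp_seq _ _ 2 (NN * (n * (c1 + 9) + 24) + 4) _ (fun s1 => s1 = setr s 7 0)).
- by apply: wp_assign.
- move=> _ -> _.
  have I0 : I NN (setr s 7 0).
    exists 0, m.+2; split=> //.
    split=> //; split; rewrite ?subnn // => i y _.
    by rewrite !ltn0 andbF.
  apply: wp_conseq (wp_while step I0) _ _; first by rewrite /=; lia.
  move=> s1 [e0 [b [p [N [_ r7 iv]]]]] _; have NNN := invN _ _ _ _ iv.
  case: iv e0 => rn1 r31 r41 pN clo /=; rewrite r31 r7 => /eqP.
  rewrite subn_eq0 leq_pmul2r // => Np.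
  have pE : p = N by lia.
  rewrite pE in clo; exists N; split=> //; last exact: closing_done clo Rm Rm1 E0.
    by case: clo => ->.
  by case: clo.
- have NN3 : 2 < NN by rewrite /NN.
  rewrite /c1 expnMn -!mulnn; nia.
Qed.

(** * Computing the levels *)

Lemma rowi_below n (M M' : nat -> nat) N i :
  (forall a, a < N * n -> M' a = M a) -> i < N -> rowi n M' i = rowi n M i.
Proof.
move=> h iN; apply: row_ext => j jn; apply: h.
have : i.+1 * n <= N * n by rewrite leq_mul2r iN orbT.
by rewrite mulSn; lia.
Qed.

(* The level of the row at address p is kept at address top + n + p. *)
Definition lev_addr p := Add (Add (Reg 3) (Reg 0)) (Reg p).

(** One level every [n] cells: a row address then serves as an offset, and no division is called
    for. Row [N] in between stays free as scratch. *)
Definition lev n N (M : nat -> nat) i := M ((N.+1 + i) * n).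

Lemma lev_addr_eq n N i s p : reg s 0 = n -> reg s 3 = N * n -> reg s p = i * n ->
  eval s (lev_addr p) = (N.+1 + i) * n.
Proof. by move=> rn r3 rp; rewrite /= rn r3 rp !mulnDl mulSn; lia. Qed.

Lemma lev_update n N (M : nat -> nat) i j v : 0 < n ->
  lev n N (update M ((N.+1 + i) * n) v) j = if j == i then v else lev n N M j.
Proof. by move=> n0; rewrite /lev /= eqn_pmul2r // eqn_add2l. Qed.

Lemma below_update n N (M : nat -> nat) i v a :
  a < N * n -> update M ((N.+1 + i) * n) v a = M a.
Proof. by move=> aN; rewrite /= ltn_eqF // (leq_trans aN) // leq_mul2r; lia. Qed.

Section Search.

Variables (n N : nat) (M : nat -> nat).
Hypothesis n0 : 0 < n.

Local Notation R := (rowi n M).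

Definition row_family : {set {set 'I_n}} := [set R i | i : 'I_N].

Local Notation L i := (level row_family (R i)).

Lemma row_family_mem i : i < N -> R i \in row_family.
Proof. by move=> iN; apply/imsetP; exists (Ordinal iN). Qed.

Definition below p t q := (t <= L q) && (R q \proper R p).

Lemma level_below p t : p < N -> (t < L p) = ~~ all_below (fun q => ~~ below p t q) N.
Proof.
move=> pN; rewrite level_ge ?row_family_mem //; apply/deepSP/idP.
  case=> _ [a ap da]; have /imsetP[q _ aq] := deep_mem da.
  apply/negP => /allP_ord/(_ q); rewrite /below -aq ap andbT.
  by rewrite level_ge ?(deep_mem da) // da.
rewrite /all_below -has_predC => /hasP[q]; rewrite mem_iota /= negbK => qN /andP[tq qp].
split; first exact: row_family_mem.
by exists (R q) => //; rewrite -level_ge // row_family_mem.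
Qed.

Definition rows_kept (s : state) := forall a, a < N * n -> mem_at s a = M a.

Definition machine_ok (s : state) := [/\ reg s 0 = n, reg s 3 = N * n & rows_kept s].

Definition reset_levels := rowloop 7 (Lit 0) (Reg 3) (Store (lev_addr 7) (Lit 0)).

Lemma wp_reset_levels s : machine_ok s ->
  wp reset_levels (30 * N.+1) (fun s' => rows_kept s' /\
     forall i, i < N -> lev n N (mem_at s') i = 0) s.
Proof.
case=> rn r3 kept.
apply: (@wp_rowloop (fun j s1 => rows_kept s1 /\
   forall i, i < j -> lev n N (mem_at s1) i = 0) n 0 N 7) => //=.
- by move=> s1 [fr _]; rewrite fr.
- move=> j s1 _ jN [fr _] r7 [kept1 l0]; apply: wp_store => //.
  have [rn1 r31] : reg s1 0 = n /\ reg s1 3 = N * n by rewrite !fr.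
  rewrite (lev_addr_eq rn1 r31 r7) /setr; split=> [a aN | i].
    by rewrite [mem_at _]/= below_update // kept1.
  rewrite ltnS leq_eqVlt [mem_at _]/= lev_update //.
  by case: eqP => //= _; apply: l0.
- by lia.
Qed.

(** Levels are known truncated: round t turns min (L, t) into min (L, t+1) by looking for a proper
    subset of level at least t. Register 14 records whether any row was raised. *)
Definition round :=
  rowloop 7 (Lit 0) (Reg 3)
    (rowloop 9 (Lit 0) (Reg 3)
       (If (Sub (Reg 11) (Mem (lev_addr 9))) Skip
          (Seq (proper_rows 9 7)
             (If (Reg 6)
                (Seq (Store (lev_addr 7) (Add (Reg 11) (Lit 1))) (Assign 14 (Lit 1)))
                Skip)))).

Lemma wp_round t s : machine_ok s -> reg s 11 = t -> reg s 14 = 0 ->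
  (forall i, i < N -> lev n N (mem_at s) i = minn (L i) t) ->
  wp round (200 * n * N.+1 ^ 2) (fun s' =>
    [/\ rows_kept s', forall i, i < N -> lev n N (mem_at s') i = minn (L i) t.+1 &
        reg s' 14 = ~~ all_below (fun i => L i <= t) N]) s.
Proof.
case=> rn r3 kept r11 r14 lv.
(* [b] tells whether a witness for row [p] has been found already, so that its entry has been raised
   within the inner loop. *)
pose inv p (b : bool) s1 := [/\ rows_kept s1,
  forall i, i < N -> lev n N (mem_at s1) i = minn (L i) (t + ((i < p) || ((i == p) && b))) &
  reg s1 14 = ~~ all_below (fun i => L i <= t) p || b].
pose fnd p j := ~~ all_below (fun q => ~~ below p t q) j.
have inv0 s1 : inv N false s1 -> [/\ rows_kept s1,
   forall i, i < N -> lev n N (mem_at s1) i = minn (L i) t.+1 &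
   reg s1 14 = ~~ all_below (fun i => L i <= t) N].
  case=> h1 h2 h3; split=> //; last by rewrite h3 orbF.
  by move=> i iN; rewrite h2 // iN addn1.
apply: (@wp_conseq _ (N * (N * (100 * n + 40) + 30) + 20) _ (inv N false)); last first.
- by move=> s1 /inv0.
- by rewrite -mulnn; nia.
apply: (@wp_rowloop (fun p s1 => inv p false s1) n 0 N (N * (100 * n + 40) + 10)) => //=.
- by move=> s1 [fr _]; rewrite fr.
- by split=> // i iN; rewrite andbF addn0 lv.
- move=> p s1 _ pN [fr _] r7 iv1.
  have [rn1 r31] : reg s1 0 = n /\ reg s1 3 = N * n by rewrite !fr.
  have r111 : reg s1 11 = t by rewrite fr.
  apply: (@wp_conseq _ _ _ (inv p (fnd p N)) _ _ _ (leqnn _)); last first.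
    move=> s2 [k2 l2 e2] [fr2 _]; split=> //= [i iN|].
      rewrite l2 // andbF orbF ltnS; case: ltngtP => //= ->.
      rewrite /fnd -level_below //.
      by case: (ltnP t (L p)); rewrite ?addn0 ?addn1; lia.
    by rewrite e2 orbF all_belowS negb_and -ltnNge level_below.
  apply: (@wp_rowloop (fun j s2 => inv p (fnd p j) s2) n 0 N (100 * n + 30)) => //=.
  + by move=> s2 [fr2 _]; rewrite fr2.
  + move=> q s2 _ qN [fr2 _] r9 [k2 l2 e2].
    have [rn2 r32] : reg s2 0 = n /\ reg s2 3 = N * n by rewrite !fr2.
    have [r112 r72] : reg s2 11 = t /\ reg s2 7 = p * n by rewrite !fr2.
    (* In-place updating does no harm: the entry of row q is min (L, t) or min (L, t+1), and both
       reach t exactly when L does. *)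
    have levq : (t - lev n N (mem_at s2) q == 0) = (t <= L q).
      by rewrite l2 //; case: (_ || _); rewrite subn_eq0 ?addn0 ?addn1; lia.
    have fS : fnd p q.+1 = fnd p q || below p t q.
      by rewrite /fnd all_belowS negb_and negbK.
    have keep s3 : ~~ below p t q -> mem_at s3 = mem_at s2 -> reg s3 14 = reg s2 14 ->
        inv p (fnd p q.+1) s3.
      move=> nb ms rs; rewrite fS (negbTE nb) orbF; split; last by rewrite rs.
        by move=> a; rewrite ms; apply: k2.
      by move=> i; rewrite ms; apply: l2.
    have EV : eval s2 (Sub (Reg 11) (Mem (lev_addr 9))) = t - lev n N (mem_at s2) q.
      by rewrite -[eval _ _]/(reg s2 11 - mem_at s2 (eval s2 (lev_addr 9))) (lev_addr_eq rn2 r32 r9) r112.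
    apply: (@wp_if _ _ _ (100 * n + 15)); rewrite ?EV; last by rewrite /=; lia.
      rewrite levq => nt; apply: wp_skip; last by lia.
      by apply: keep => //; rewrite /below (negbTE nt).
    move/eqP; rewrite levq => tq.
    apply: (wp_seq (c2 := 14) (@wp_proper_rows n 9 7 _ _ s2 rn2 n0 isT isT r9 r72)); last by lia.
    move=> s3; rewrite -!/(rowi _ _ _) !(rowi_below k2) // => r6 [fr3 fm3].
    apply: (@wp_if _ _ _ 12) => //=; rewrite r6 => h.
      have bl : below p t q by rewrite /below tq (nat_of_bool_neq0 h).
      apply: (@wp_seq _ _ 9 2 _ (fun s4 => mem_at s4 = update (mem_at s2) ((N.+1 + p) * n) t.+1)) => //.
        apply: wp_store => //.
        have [rn3 r33] : reg s3 0 = n /\ reg s3 3 = N * n by rewrite !fr3.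
        have r73 : reg s3 7 = p * n by rewrite fr3.
        rewrite -[LHS]/(update (mem_at s3) (eval s3 (lev_addr 7)) (reg s3 11 + 1)).
        by rewrite (lev_addr_eq rn3 r33 r73) fm3 // fr3 //= r112 addn1.
      move=> s4 m4 _; apply: wp_assign => //.
      rewrite fS bl orbT; split.
      * by move=> a aN; rewrite /= m4 below_update // k2.
      * move=> i iN; rewrite /= m4 lev_update //; case: eqP => [->|ne] /=.
          have : t < L p.
            rewrite level_below // -/(fnd p N) /fnd; apply/negP => /allP_ord/(_ (Ordinal qN)).
            by rewrite /= bl.
          by rewrite orbT; lia.
        by rewrite l2 //= (introF eqP ne).
      * by rewrite /= orbT.
    apply: wp_skip => //; apply: keep; rewrite /= ?fm3 ?fr3 //.
    by rewrite /below negb_and (nat_of_bool_eq0 h) orbT.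
  + by lia.
- by lia.
Qed.
End Search.

(** * Finding an edge to group *)

Definition count_row :=
  Seq (Assign 15 (Lit 0))
    (cols (If (Mem (Add (Reg 7) (Reg 5))) (Assign 15 (Add (Reg 15) (Lit 1))) Skip)).

Lemma wp_count_row n p s : 0 < n -> reg s 0 = n -> reg s 7 = p * n ->
  wp count_row (40 * n) (fun s' => reg s' 15 = #|rowi n (mem_at s) p|) s.
Proof.
move=> n0 rn r7; set M := mem_at s.
apply: (@wp_seq _ _ 2 (30 * n) _ (fun s1 => s1 = setr s 15 0)); last by lia.
  by apply: wp_assign.
move=> _ -> _.
have -> : #|rowi n M p| = \sum_(0 <= i < n) (M (p * n + i) != 0).
  by rewrite big_mkord -sum1_card big_mkcond; apply: eq_bigr => i _; rewrite inE; case: (_ != 0).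
apply: (@wp_cols (fun j s1 => reg s1 15 = \sum_(0 <= i < j) (M (p * n + i) != 0)) n 12) => //=.
- by rewrite big_geq.
- move=> j s1 jn [fr fm] r5 r15.
  have r71 : reg s1 7 = p * n by rewrite fr.
  have fm1 : mem_at s1 = M by rewrite fm.
  apply: (@wp_if _ _ _ 6) => //=; rewrite r71 r5 fm1 => h.
    by apply: wp_assign => //=; rewrite big_nat_recr //= h r15.
  by apply: wp_skip => //=; rewrite big_nat_recr //= h r15 addn0.
- by lia.
Qed.

Section Candidates.

Variables (n N : nat) (M : nat -> nat).
Hypothesis n0 : 0 < n.

Local Notation R := (rowi n M).
Local Notation L i := (level (row_family n N M) (R i)).
Local Notation ok := (machine_ok n N M).
Local Notation kept := (rows_kept n N M).

Definition cand t K i := (L i == t) && (K < #|R i|).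

(** Runs after round t, since an entry min (L, t+1) tells level t from higher ones. Equality is
    tested by adding the two truncated differences. *)
Definition check_rows :=
  rowloop 7 (Lit 0) (Reg 3)
    (If (Add (Sub (Mem (lev_addr 7)) (Reg 11)) (Sub (Reg 11) (Mem (lev_addr 7)))) Skip
       (Seq count_row
          (If (Sub (Reg 15) (Reg 12)) (Seq (Assign 16 (Reg 7)) (Assign 13 (Lit 1))) Skip))).

Lemma wp_check_rows t K s : ok s -> reg s 11 = t -> reg s 12 = K -> reg s 13 = 0 ->
  (forall i, i < N -> lev n N (mem_at s) i = minn (L i) t.+1) ->
  wp check_rows (90 * n * N.+1) (fun s' =>
    [/\ mem_at s' = mem_at s,
        reg s' 13 = ~~ all_below (fun i => ~~ cand t K i) N &
        reg s' 13 != 0 -> exists2 g, g < N & cand t K g /\ reg s' 16 = g * n]) s.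
Proof.
case=> rn r3 rk r11 r12 r13 lv.
apply: (@wp_rowloop (fun j s1 => [/\ mem_at s1 = mem_at s,
        reg s1 13 = ~~ all_below (fun i => ~~ cand t K i) j &
        reg s1 13 != 0 -> exists2 g, g < N & cand t K g /\ reg s1 16 = g * n])
   n 0 N (40 * n + 30)) => //=.
- by move=> s1 [fr _]; rewrite fr.
- by rewrite r13.
- move=> j s1 _ jN [fr _] r7 [ms r131 r161].
  have [rn1 r31] : reg s1 0 = n /\ reg s1 3 = N * n by rewrite !fr.
  have [r111 r121] : reg s1 11 = t /\ reg s1 12 = K by rewrite !fr.
  have skip s2 : ~~ cand t K j -> mem_at s2 = mem_at s -> reg s2 13 = reg s1 13 ->
     reg s2 16 = reg s1 16 -> [/\ mem_at s2 = mem_at s,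
        reg s2 13 = ~~ all_below (fun i => ~~ cand t K i) j.+1 &
        reg s2 13 != 0 -> exists2 g, g < N & cand t K g /\ reg s2 16 = g * n].
    by move=> nc m2 e13 e16; rewrite all_belowS nc andbT m2 e13 e16.
  set EV := eval s1 (Add (Sub (Mem (lev_addr 7)) (Reg 11)) (Sub (Reg 11) (Mem (lev_addr 7)))).
  have evE : (EV == 0) = (L j == t).
    rewrite /EV; set e := eval _ _.
    have -> : e = (minn (L j) t.+1 - t) + (t - minn (L j) t.+1).
      rewrite /e -[LHS]/((mem_at s1 (eval s1 (lev_addr 7)) - reg s1 11) +
         (reg s1 11 - mem_at s1 (eval s1 (lev_addr 7)))) (lev_addr_eq rn1 r31 r7) r111 ms.
      by rewrite -!/(lev n N (mem_at s) j) lv.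
    by lia.
  apply: (@wp_if _ _ _ (40 * n + 12)); rewrite -/EV; last by rewrite /=; lia.
    rewrite evE => nt; apply: wp_skip; last by lia.
    by apply: skip => //; rewrite /cand (negbTE nt).
  move/eqP; rewrite evE => Lt.
  apply: (wp_seq (c2 := 10) (wp_count_row n0 rn1 r7)); last by lia.
  move=> s2; rewrite ms (rowi_below rk jN) => r15 [fr2 fm2].
  apply: (@wp_if _ _ _ 6) => //=; rewrite r15 fr2 //= r121 => h.
    have cj : cand t K j by rewrite /cand Lt; move: h; rewrite subn_eq0 -ltnNge.
    apply: (@wp_seq _ _ 2 2 _ (fun s3 => s3 = setr s2 16 (j * n))) => //.
      by apply: wp_assign => //=; rewrite fr2 //= r7.
    move=> s3 -> _; apply: wp_assign => //=; split; first by rewrite fm2.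
      by rewrite all_belowS cj andbF.
    by move=> _; exists j.
  apply: wp_skip => //; apply: skip; rewrite /= ?fm2 ?fr2 //.
  by rewrite /cand Lt /=; move/eqP: h; rewrite subn_eq0 -leqNgt.
- by nia.
Qed.

Variable k : nat.
Hypothesis k0 : 0 < k.

(* A power of k of size at least n need not be known exactly. *)
Definition capped t K := forall c, c <= n -> (K < c) = (k ^ t.-1 < c).

(** Multiplies by k through K additions, which is affordable because nothing is done once K >= n.
    Nothing is done at t = 0 either, as t.-1 is 0 for both t = 0 and t = 1. *)
Definition power :=
  If (Reg 11)
    (If (Sub (Reg 0) (Reg 12))
       (Seq (Seq (Assign 15 (Lit 0))
               (loop 5 (Lit 0) (Reg 12) (Lit 1) (Assign 15 (Add (Reg 15) (Reg 2)))))
            (Assign 12 (Reg 15)))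
       Skip)
    Skip.

Lemma wp_power t s : reg s 0 = n -> reg s 2 = k -> reg s 11 = t ->
  capped t (reg s 12) ->
  wp power (60 * n) (fun s' => capped t.+1 (reg s' 12)) s.
Proof.
move=> rn r2 r11; set K := reg s 12 => cK.
apply: (@wp_if _ _ _ (50 * n)) => /=; rewrite ?r11; last by lia.
  move=> t0; apply: (@wp_if _ _ _ (40 * n)) => /=; rewrite ?rn -/K; last by lia.
    rewrite subn_eq0 -ltnNge => Kn.
    (* Below n the cap is inactive: comparing with c = K and c = K + 1 pins the power down. *)
    have KE : K = k ^ t.-1.
      have := cK _ Kn; have := cK _ (ltnW Kn); rewrite -/K ltnn ltnSn.
      by move/esym/negbT; rewrite -leqNgt => h1 /esym h2; lia.
    apply: (@wp_seq _ _ (20 * n + 10) 2 _ (fun s1 => reg s1 15 = K * k)); last by lia.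
      apply: (@wp_seq _ _ 2 (13 * K + 7) _ (fun s1 => s1 = setr s 15 0)); last by lia.
        by apply: wp_assign.
      move=> _ -> _.
      apply: (@wp_loop (fun j s1 => reg s1 15 = j * k) K 0 1 K 4) => //=.
      - by move=> j _; rewrite muln1.
      - by move=> s1 [fr _]; rewrite fr.
      - move=> j s1 jm [fr _] _ r15; apply: wp_assign => //=.
        by rewrite r15 fr //= r2 mulSn addnC.
      - by lia.
    move=> s1 r15 _; apply: wp_assign => //= c cn.
    by rewrite r15 KE mulnC -expnS prednK ?lt0n.
  move=> /eqP; rewrite subn_eq0 => nK; apply: wp_skip; last by lia.
  move=> c cn; rewrite -/K cK //=; apply/idP/idP => [h|].
    by rewrite -cK // in h; lia.
  by apply: leq_ltn_trans; rewrite leq_pexp2l // leq_pred.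
move=> t0; apply: wp_skip; last by lia.
by move=> c cn; rewrite -/K cK // t0.
Qed.
End Candidates.

Definition search_step :=
  Seq (Assign 14 (Lit 0)) (Seq round (Seq check_rows
    (If (Reg 13) (Assign 14 (Lit 0))
       (Seq power (Assign 11 (Add (Reg 11) (Lit 1))))))).

Definition search :=
  Seq reset_levels (Seq (Assign 11 (Lit 0)) (Seq (Assign 12 (Lit 1))
    (Seq (Assign 13 (Lit 0)) (Seq (Assign 14 (Lit 1)) (While (Reg 14) search_step))))).

Section Search.

Variables (n N k D : nat) (M : nat -> nat).
Hypotheses (n0 : 0 < n) (k0 : 0 < k).

Local Notation R := (rowi n M).
Local Notation L i := (level (row_family n N M) (R i)).
Local Notation ok := (machine_ok n N M).
Local Notation kept := (rows_kept n N M).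

Hypothesis LD : forall i, i < N -> L i <= D.
Hypothesis L0 : forall i, i < N -> L i = 0 -> R i = set0.

Definition bad i := (0 < L i) && (k ^ (L i).-1 < #|R i|).

Definition search_result s :=
  (reg s 13 = 0 /\ forall i, i < N -> ~~ bad i) \/
  (reg s 13 <> 0 /\ exists g, [/\ g < N, reg s 16 = g * n, bad g &
     forall i, i < N -> bad i -> L g <= L i]).

(** Lower levels have been searched in vain, so the first violation found is minimal. The flag says
    that the last round raised some row, that is, some level exceeds t - 1; at t = 0 it is set by
    hand. *)
Definition search_going t s :=
  [/\ reg s 13 = 0 /\ reg s 11 = t, capped n k t (reg s 12),
      forall i, i < N -> lev n N (mem_at s) i = minn (L i) t,
      forall i, i < N -> bad i -> t <= L i &
      reg s 14 = (t == 0) || ~~ all_below (fun i => L i <= t.-1) N].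

Definition search_inv b s :=
  [/\ ok s, reg s 2 = k &
   (reg s 14 = 0 /\ search_result s) \/ exists2 t, b = D.+1 - t & search_going t s].

Lemma capped_card t K (i : nat) : capped n k t K ->
  (K < #|R i|) = (k ^ t.-1 < #|R i|).
Proof. by apply; rewrite -[X in _ <= X]card_ord max_card. Qed.

Lemma search_stepP b s : search_inv b s -> eval s (Reg 14) != 0 ->
  exists2 b', b = b'.+1 & wp search_step (500 * n * N.+1 ^ 2) (search_inv b') s.
Proof.
case=> oks r2 cases /= going; case: cases => [[e _]|]; first by rewrite e in going.
case=> t -> [[r13 r11] cK lv bad_ge r14].
have tD : t <= D.
  move: going; rewrite r14; case: (posnP t) => [->//|t0].
  rewrite /= => /nat_of_bool_neq0.
  rewrite /all_below -has_predC => /hasP[i]; rewrite mem_iota /= -ltnNge => iN h.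
  by have := LD iN; lia.
exists (D - t); first by lia.
have [rn r3 rk] := oks.
apply: (@wp_seq _ _ 2 (300 * n * N.+1 ^ 2 + 130 * n) _ (fun s1 => s1 = setr s 14 0)); last by rewrite -mulnn; nia.
  by apply: wp_assign.
move=> _ -> _; set s1 := setr s 14 0.
have ok1 : ok s1 by [].
have r111 : reg s1 11 = t by [].
have r141 : reg s1 14 = 0 by [].
apply: (wp_seq (c2 := 100 * n * N.+1 + 100 * n) (wp_round n0 ok1 r111 r141 lv)); last by rewrite -mulnn; nia.
move=> s2 [k2 lv2 r142] [fr2 _].
have ok2 : ok s2 by split; rewrite ?fr2.
have [r112 r122 r132] : [/\ reg s2 11 = t, reg s2 12 = reg s 12 & reg s2 13 = 0].
  by rewrite !fr2.
apply: (wp_seq (c2 := 80 * n) (wp_check_rows n0 ok2 r112 r122 r132 lv2)); last by nia.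
move=> s3 [ms3 r133 f3] [fr3 _].
have r23 : reg s3 2 = k by rewrite !fr3 // !fr2.
have ok3 : ok s3 by case: ok2 => h1 h2 h3; split; rewrite ?fr3 // => a; rewrite ms3; apply: h3.
(* At t = 0 the exponent is truncated to 0, but rows of level 0 are empty, so none passes the
   test. *)
have candE i : i < N -> cand n N M t (reg s 12) i = (L i == t) && bad i.
  move=> iN; rewrite /cand; case: eqP => //= Li; rewrite (capped_card i cK) /bad Li.
  case: (posnP t) => //= t0; rewrite t0 in Li *.
  by rewrite (L0 iN Li) cards0 ltn0.
apply: (@wp_if _ _ _ (70 * n)) => /=; last by lia.
  move=> /f3[g gN [cg rg]]; apply: wp_assign; last by rewrite /=; lia.
  have [h1 h2 h3] := ok3.
  split; rewrite /= //; left; split=> //; right; split=> /=.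
    move=> h; move: r133; rewrite h => /esym/nat_of_bool_eq0; rewrite negbK.
    by move/allP_ord/(_ (Ordinal gN)); rewrite /= cg.
  move: (cg); rewrite candE // => /andP[/eqP Lg bg]; exists g; split=> // i iN bi.
  by rewrite Lg bad_ge.
move=> r130; move: r133; rewrite r130 => /esym/nat_of_bool_eq0; rewrite negbK => /allP_ord nc.
have [rn3 r33 k3] := ok3.
have [r113 r123] : reg s3 11 = t /\ reg s3 12 = reg s 12 by rewrite !fr3 // !fr2.
have cK3 : capped n k t (reg s3 12) by rewrite r123.
apply: (wp_seq (c2 := 4) (wp_power n0 k0 rn3 r23 r113 cK3)); last by lia.
have r143 : reg s3 14 = reg s2 14 by rewrite fr3.
move=> s4 cK4 [fr4 fm4]; apply: wp_assign => //=; split.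
- by split=> /=; rewrite ?fr4 // => a; rewrite /= fm4 //; apply: k3.
- by rewrite /= fr4.
right; exists t.+1; first by rewrite subSS.
split=> //=.
- by rewrite !fr4 //= r113 addn1.
- by move=> i iN; rewrite fm4 // ms3 lv2.
- move=> i iN bi; rewrite ltn_neqAle bad_ge // andbT.
  by have := nc (Ordinal iN); rewrite /= candE // bi andbT eq_sym.
- by rewrite fr4 //= r143 r142.
Qed.

Lemma wp_search s : ok s -> reg s 2 = k ->
  wp search (600 * n * N.+1 ^ 2 * D.+2)
    (fun s' => [/\ ok s', reg s' 2 = k & search_result s']) s.
Proof.
move=> oks r2; have [rn r3 rk] := oks.
apply: (wp_seq (c2 := D.+1 * (500 * n * N.+1 ^ 2 + 2) + 22) (wp_reset_levels n0 oks)); last first.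
  by rewrite -mulnn; nia.
move=> s1 [k1 lv1] [fr1 _].
apply: (@wp_seq _ _ 2 (D.+1 * (500 * n * N.+1 ^ 2 + 2) + 17) _ (fun s2 => s2 = setr s1 11 0)); last by lia.
  by apply: wp_assign.
move=> _ -> _; set s2 := setr _ _ _.
apply: (@wp_seq _ _ 2 (D.+1 * (500 * n * N.+1 ^ 2 + 2) + 13) _ (fun s3 => s3 = setr s2 12 1)); last by lia.
  by apply: wp_assign.
move=> _ -> _; set s3 := setr _ _ _.
apply: (@wp_seq _ _ 2 (D.+1 * (500 * n * N.+1 ^ 2 + 2) + 9) _ (fun s4 => s4 = setr s3 13 0)); last by lia.
  by apply: wp_assign.
move=> _ -> _; set s4 := setr _ _ _.
apply: (@wp_seq _ _ 2 (D.+1 * (500 * n * N.+1 ^ 2 + 2) + 5) _ (fun s5 => s5 = setr s4 14 1)); last by lia.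
  by apply: wp_assign.
move=> _ -> _; set s5 := setr _ _ _.
have I0 : search_inv D.+1 s5.
  split; rewrite /= ?fr1 //; first by split; rewrite /= ?fr1.
  right; exists 0; rewrite ?subn0 //; split=> //= i iN.
apply: wp_conseq (wp_while search_stepP I0) _ _; first by rewrite /=; lia.
move=> s6 [/= e [b [ok6 r26 [[_ //] | [t _ [[r13 _] _ _ bad_ge r14]]]]]] _.
split=> //; left; split=> // i iN; apply/negP => bi.
(* At the exit all levels are below t, whereas a violating row would have level at least t. *)
move: r14; rewrite e => /esym/nat_of_bool_eq0; rewrite negb_or negbK => /andP[t0 /allP_ord/(_ (Ordinal iN)) /=].
by have := bad_ge i iN bi; lia.
Qed.
End Search.

(** * Grouping the rows in place *)

Definition merged (T : finType) (S : {set T}) r (A : {set T}) : {set T} :=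
  (A :\: S) :|: (if S \subset A then [set r] else set0).

Lemma addr_inj n i i' (j j' : 'I_n) : i * n + j = i' * n + j' -> i = i' /\ j = j'.
Proof.
move=> e; have n0 : 0 < n := leq_ltn_trans (leq0n j) (ltn_ord j).
have ii : i = i'.
  by have := congr1 (divn^~ n) e; rewrite !divnMDl // !divn_small ?ltn_ord // !addn0.
by split=> //; apply: val_inj; move: e; rewrite ii => /addnI.
Qed.

Lemma rowi_update n M p (r : 'I_n) i :
  rowi n (update M (p * n + r) 1) i = if i == p then r |: rowi n M p else rowi n M i.
Proof.
apply/setP => j; rewrite !inE /=.
case: (i * n + j =P p * n + r) => [/addr_inj[-> ->]|ne]; first by rewrite eqxx !inE eqxx.
case: (i =P p) => [ip|_]; rewrite !inE ?ip //; case: (j =P r) => // jr.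
by rewrite ip jr in ne.
Qed.

(** The edge is copied to the scratch row first, since its own row is altered when the loop reaches
    it. The inclusion is tested before the columns of the row are cleared. *)
Definition group_rows :=
  Seq (cols (If (Mem (Add (Reg 16) (Reg 5))) (Assign 15 (Reg 5)) Skip))
  (Seq (cols (If (Mem (Add (Reg 16) (Reg 5))) (Store (Add (Reg 3) (Reg 5)) (Lit 1))
                 (Store (Add (Reg 3) (Reg 5)) (Lit 0))))
  (rowloop 7 (Lit 0) (Reg 3)
     (Seq (subset_rows 3 7)
     (Seq (cols (If (Mem (Add (Reg 3) (Reg 5))) (Store (Add (Reg 7) (Reg 5)) (Lit 0)) Skip))
          (If (Reg 6) (Store (Add (Reg 7) (Reg 15)) (Lit 1)) Skip))))).

Lemma wp_group_rows n N g s : 0 < n -> reg s 0 = n -> reg s 3 = N * n ->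
  reg s 16 = g * n -> g < N ->
  let R := rowi n (mem_at s) in
  R g != set0 ->
  wp group_rows (200 * n * N.+1) (fun s' => exists2 r, r \in R g &
     forall i, i < N -> rowi n (mem_at s') i = merged (R g) r (R i)) s.
Proof.
move=> n0 rn r3 r16 gN R /set0Pn[r0 r0S]; set M := mem_at s.
apply: (@wp_seq _ _ (25 * n) (170 * n * N.+1) _
  (fun s1 => exists2 r, r \in R g & reg s1 15 = r)); last by nia.
  apply: (@wp_conseq _ (25 * n) _ (fun s1 => r0 < n -> exists2 r, r \in R g & reg s1 15 = r)) => //; last first.
    by move=> s1 h _; apply: h.
  apply: (@wp_cols (fun j s1 => r0 < j -> exists2 r, r \in R g & reg s1 15 = r) n 8) => //; last by lia.
  move=> j s1 jn [fr fm] r5 IH.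
  have fm1 : mem_at s1 = M by rewrite fm.
  have r161 : reg s1 16 = g * n by rewrite fr.
  apply: (@wp_if _ _ _ 3) => //=; rewrite r161 r5 fm1 => h.
    apply: wp_assign => //= _; exists (Ordinal jn) => //.
    by rewrite inE.
  apply: wp_skip => //=; rewrite ltnS leq_eqVlt => /orP[/eqP rj|]; last exact: IH.
  by move: r0S; rewrite inE rj -/M h.
move=> s1 [r rS r15] [fr fm].
have fm1 : mem_at s1 = M by rewrite fm.
pose cp j := nat_of_bool (M (g * n + j) != 0).
apply: (@wp_seq _ _ (20 * n + 7) (140 * n * N.+1) _
  (fun s2 => rowi n (mem_at s2) N = R g /\ forall i, i < N -> rowi n (mem_at s2) i = R i)); last by nia.
  apply: wp_conseq (@wp_mapcols n 11 (20 * n + 7) _ (N * n) cp s1 _ _ _ _ _) _ _ => //.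
  - by rewrite fr.
  - move=> j s2 jn [fr2 _] r5 m2.
    have e1 : mem_at s2 (g * n + j) = M (g * n + j).
      rewrite m2 fm1; case: ifP => // /andP[h1 h2].
      have : g * n + n <= N * n by rewrite addnC -mulSn leq_mul2r; lia.
      by lia.
    have rr : [/\ reg s2 16 = g * n & reg s2 3 = N * n] by rewrite !fr2 // !fr.
    case: rr => r162 r32.
    apply: (@wp_if _ _ _ 6) => //=; rewrite r162 r5 e1 => h.
      by apply: wp_store => //= a; rewrite r32 r5 /cp h.
    by apply: wp_store => //= a; rewrite r32 r5 /cp h.
  - by lia.
  - move=> s2 m2 _; split=> [|i iN]; last first.
      by rewrite /rowi (row_outside (new := cp) m2) ?fm1 //; lia.
    rewrite /rowi (row_inside (new := cp) m2); apply/setP => j; rewrite !inE /cp -/M.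
    by case: (M (g * n + j) != 0).
move=> s2 [RN Rlt] [fr2 _].
apply: (@wp_conseq _ _ _ (fun s3 => rowi n (mem_at s3) N = R g /\ forall i, i < N ->
   rowi n (mem_at s3) i = if i < N then merged (R g) r (R i) else R i) _ _ _ (leqnn _)); last first.
  by move=> s3 [_ h] _; exists r => // i iN; rewrite h // iN.
apply: (@wp_rowloop (fun j s3 => rowi n (mem_at s3) N = R g /\ forall i, i < N ->
   rowi n (mem_at s3) i = if i < j then merged (R g) r (R i) else R i) n 0 N (100 * n)) => //=.
- by rewrite !fr2 // fr.
- by move=> s3 [fr3 _]; rewrite fr3 // fr2 // fr.
- move=> p s3 _ pN [fr3 _] r7 [RN3 R3].
  have [rn3 r33 r153] : [/\ reg s3 0 = n, reg s3 3 = N * n & reg s3 15 = r].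
    by rewrite !fr3 // !fr2 // r15 !fr.
  apply: (wp_seq (c2 := 55 * n) (@wp_subset_rows n 3 7 _ _ s3 rn3 n0 isT isT r33 r7)); last by lia.
  move=> s4; rewrite -!/(rowi _ _ _) RN3 R3 // ltnn => r64 [fr4 fm4].
  pose nw j := if mem_at s3 (N * n + j) != 0 then 0 else mem_at s3 (p * n + j).
  apply: (@wp_seq _ _ (20 * n + 7) 8 _ (fun s5 => rowi n (mem_at s5) p = R p :\: R g /\
      forall i, i != p -> rowi n (mem_at s5) i = rowi n (mem_at s3) i)); last by lia.
    apply: wp_conseq (@wp_mapcols n 11 (20 * n + 7) _ (p * n) nw s4 _ _ _ _ _) _ _ => //.
    + by rewrite fr4.
    + move=> j s5 jn [fr5 _] r5 m5.
      have [r35 r75] : reg s5 3 = N * n /\ reg s5 7 = p * n by rewrite !fr5 // !fr4.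
      have e1 : mem_at s5 (N * n + j) = mem_at s3 (N * n + j).
        rewrite m5 fm4 //; case: ifP => // /andP[h1 h2].
        have : p * n + n <= N * n by rewrite addnC -mulSn leq_mul2r; lia.
        by lia.
      apply: (@wp_if _ _ _ 6) => //=; rewrite r35 r5 e1 => h.
        by apply: wp_store => //= a; rewrite r75 r5 /nw h.
      apply: wp_skip => // a; case: eqP => // ->; rewrite /nw h m5 fm4 //.
      by case: ifP => //; lia.
    + by lia.
    + move=> s5 m5 _; split=> [|i ip]; last first.
        by rewrite /rowi (row_outside (new := nw) m5) ?fm4.
      rewrite {1}/rowi (row_inside (new := nw) m5) -RN3.
      have -> : R p = rowi n (mem_at s3) p by rewrite R3 // ltnn.
      apply/setP => j; rewrite !inE /nw.
      by case: (mem_at s3 (N * n + j) != 0).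
  move=> s5 [Rp Ro] [fr5 _].
  have [r75 r155] : reg s5 7 = p * n /\ reg s5 15 = r by rewrite !fr5 // !fr4.
  have r65 : reg s5 6 = (R g \subset R p) by rewrite fr5.
  have fin (M' : nat -> nat) : rowi n M' p = merged (R g) r (R p) ->
      (forall i, i != p -> rowi n M' i = rowi n (mem_at s3) i) ->
      rowi n M' N = R g /\ (forall i, i < N ->
        rowi n M' i = if i < p.+1 then merged (R g) r (R i) else R i).
    move=> Mp Mo; split; first by rewrite Mo //; lia.
    move=> i iN; case: (i =P p) => [->|/eqP ip]; first by rewrite Mp leqnn.
    rewrite Mo // R3 // ltnS; by rewrite (ltn_neqAle i p) ip.
  apply: (@wp_if _ _ _ 6) => //=; rewrite r65 => h.
    apply: wp_store => //; rewrite /= r75 r155; apply: fin => [|i ip].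
      by rewrite rowi_update eqxx Rp /merged (nat_of_bool_neq0 h) setUC.
    by rewrite rowi_update (negbTE ip) Ro.
  apply: wp_skip => //; apply: fin => //=.
  by rewrite Rp /merged (negbTE (nat_of_bool_eq0 h)) setU0.
- by nia.
Qed.

(** * Rows as an encoding of the current hypergraph *)

Section Encoding.

Variables (n m N : nat).

(** Only the sets of rows are compared, because grouping may make rows coincide. Row [m.+1], the
    image of the full vertex set, tells which columns still stand for vertices. *)
Definition encodes H (v : vertex H -> 'I_n) (R : nat -> {set 'I_n}) :=
  [/\ injective v,
      [set R i | i : 'I_m] = [set v @: e | e : {set vertex H} in edges H],
      [set R i | i : 'I_N] = [set v @: e | e : {set vertex H} in intersection_closure (edges H)] &
      R m.+1 = v @: setT].

Hypothesis mN : m.+1 < N.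

Lemma encodes_group H (v : vertex H -> 'I_n) R R' (e : {set vertex H}) r :
  encodes v R -> r \in v @: e ->
  (forall i, i < N -> R' i = merged (v @: e) r (R i)) ->
  exists v' : vertex (group e) -> 'I_n, encodes v' R'.
Proof.
move=> [vi Re Rc Rm] /imsetP[y ye ry] R'E.
pose v' (u : vertex (group e)) := if u is Some x then v (val x) else r.
have mergeE (a : {set vertex H}) : merged (v @: e) r (v @: a) = v' @: group_edge e a.
  apply/setP => j; apply/idP/idP.
    rewrite inE => /orP[/setDP[/imsetP[x xa ->] xe] | ].
      rewrite mem_imset // in xe.
      by apply/imsetP; exists (Some (exist _ x xe)); rewrite ?inE.
    case: ifP => [sub|_]; last by rewrite inE.
    rewrite inE => /eqP->; apply/imsetP; exists None; rewrite // inE.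
    apply/subsetP => x xe; have := subsetP sub (v x).
    by rewrite !mem_imset //; apply.
  case/imsetP => -[[x xe]|]; rewrite inE /= => h ->; rewrite inE.
    by rewrite inE !mem_imset // xe h.
  by rewrite imsetS // inE eqxx orbT.
have fam (K : nat) (F : {set {set vertex H}}) : K <= N ->
    [set R i | i : 'I_K] = [set v @: a | a : {set vertex H} in F] ->
    [set R' i | i : 'I_K] = [set v' @: a | a : {set vertex (group e)} in [set group_edge e b | b in F]].
  move=> KN RF; have -> : [set R' i | i : 'I_K] = [set merged (v @: e) r A | A in [set R i | i : 'I_K]].
    rewrite -imset_comp; apply: eq_imset => i /=; rewrite R'E //.
    exact: leq_trans (ltn_ord i) KN.
  by rewrite RF -!imset_comp; apply: eq_imset => a /=; rewrite mergeE.
exists v'; split.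
- move=> [[x xe]|] [[x' xe']|] //= => [/vi xx|h|h].
  + by congr Some; apply: val_inj.
  + by have xy : x = y by [apply: vi; rewrite -ry]; case/negP: (xe); rewrite xy.
  + by have xy : x' = y by [apply: vi; rewrite -ry]; case/negP: (xe'); rewrite xy.
- by apply: fam; [lia | exact: Re].
- by rewrite group_closure; apply: fam.
- by rewrite R'E // Rm mergeE group_edgeT.
Qed.

End Encoding.

Lemma imset_inj_proper (T T' : finType) (f : T -> T') : injective f ->
  forall a b : {set T}, (f @: a \proper f @: b) = (a \proper b).
Proof.
move=> fi; have sub (a b : {set T}) : (f @: a \subset f @: b) = (a \subset b).
  apply/idP/idP => [/subsetP h | h]; last exact: imsetS.
  by apply/subsetP => x xa; rewrite -(mem_imset b x fi) h // imset_f.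
by move=> a b; rewrite !properE !sub.
Qed.

Lemma encodes_level n m N H (v : vertex H -> 'I_n) M i :
  encodes m N v (rowi n M) -> i < N ->
  exists e : {set vertex H}, [/\ e \in intersection_closure (edges H),
    rowi n M i = v @: e &
    level (row_family n N M) (rowi n M i) = level (intersection_closure (edges H)) e].
Proof.
case=> vi _ Rc _ iN; have := row_family_mem n M iN.
rewrite {1}/row_family Rc => /imsetP[e eE Re]; exists e; split=> //.
by rewrite Re /row_family Rc level_imset //; [exact: imset_inj_proper | exact: imset_inj].
Qed.

Definition kernelize_rows :=
  Seq (Assign 13 (Lit 1))
    (While (Reg 13) (Seq search (If (Reg 13) group_rows Skip))).

Lemma wp_kernelize_rows n m N k d H (v : vertex H -> 'I_n) s :
  0 < n -> 0 < k -> m.+1 < N -> reduced H -> flat d H ->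
  reg s 0 = n -> reg s 2 = k -> reg s 3 = N * n ->
  encodes m N v (rowi n (mem_at s)) ->
  wp kernelize_rows (2000 * (n * N.+1) ^ 2 * d.+3) (fun s' =>
    exists Hr (vr : vertex Hr -> 'I_n),
      encodes m N vr (rowi n (mem_at s')) /\ kernelize_set_cover k H Hr) s.
Proof.
move=> n0 k0 mN rH fH rn r2 r3 enc.
(* Runs are defined from the front, so the steps already made are kept as a function that extends a
   run from [Hc] to one from [H]. The vertex count bounds the remaining iterations. *)
pose J b s1 := [/\ reg s1 0 = n, reg s1 2 = k, reg s1 3 = N * n &
  exists Hc (vc : vertex Hc -> 'I_n),
    [/\ reduced Hc, flat d Hc, encodes m N vc (rowi n (mem_at s1)),
        forall Hr, kernelize_set_cover k Hc Hr -> kernelize_set_cover k H Hr &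
        (reg s1 13 = 0 /\ forall (e : {set vertex Hc}) i, ~~ in_Z k e i) \/
        (reg s1 13 <> 0 /\ #|vertex Hc| < b)]].
pose c1 := 600 * n * N.+1 ^ 2 * d.+3 + 200 * n * N.+1 + 10.
have step b s1 : J b s1 -> eval s1 (Reg 13) != 0 ->
    exists2 b', b = b'.+1 & wp (Seq search (If (Reg 13) group_rows Skip)) c1 (J b') s1.
  case=> rn1 r21 r31 [Hc [vc [rHc fHc encc toH cases]]] /= going.
  case: cases => [[e _]|[_ cb]]; first by rewrite e in going.
  case: b cb => // b cb; exists b => //.
  set M := mem_at s1; have oks : machine_ok n N M s1 by [].
  have LE i (iN : i < N) := encodes_level encc iN.
  have LD i : i < N -> level (row_family n N M) (rowi n M i) <= d.+1.
    by move=> /LE[e [eE _ ->]]; apply: flat_level.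
  have L0 i : i < N -> level (row_family n N M) (rowi n M i) = 0 -> rowi n M i = set0.
    move=> /LE[e [eE -> ->]] /(level0 (reduced_closure rHc) eE) ->.
    by rewrite imset0.
  have vi : injective vc by case: encc.
  have badE i (e : {set vertex Hc}) : rowi n M i = vc @: e ->
      e \in intersection_closure (edges Hc) ->
      level (row_family n N M) (rowi n M i) = level (intersection_closure (edges Hc)) e ->
      bad n N k M i = in_Z k e (level (intersection_closure (edges Hc)) e).
    by move=> Re eE Le; rewrite /bad /in_Z Le Re card_imset // eE eqxx /=.
  have ofE (e : {set vertex Hc}) : e \in intersection_closure (edges Hc) ->
      exists2 i, i < N & rowi n M i = vc @: e.
    move=> eE; case: encc => _ _ Rc _; have : vc @: e \in [set rowi n M i | i : 'I_N].
      by rewrite Rc; apply: imset_f.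
    by case/imsetP => i _ h; exists i.
  have ofZ (e : {set vertex Hc}) l : in_Z k e l -> exists i, [/\ i < N, bad n N k M i &
      level (row_family n N M) (rowi n M i) = l].
    move=> eZ; have /and4P[eE _ /eqP le _] := eZ.
    have [i iN Re] := ofE e eE; have [e' [e'E Re' Le']] := LE i iN.
    have ee : e' = e by apply: (imset_inj vi); rewrite -Re -Re'.
    subst e'; exists i; split=> //; last by rewrite Le' le.
    by rewrite (badE i e) // le.
  apply: (wp_seq (c2 := 200 * n * N.+1 + 5) (wp_search n0 k0 LD L0 oks r21)); last first.
    by rewrite /c1; lia.
  move=> s2 [[rn2 r32 k2] r22 res] _.
  have keep i : i < N -> rowi n (mem_at s2) i = rowi n M i by apply: rowi_below.
  apply: (@wp_if _ _ _ (200 * n * N.+1 + 2)) => /=; last by lia.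
    move=> found; case: res => [[r13 _]|[_ [g [gN r16 bg gmin]]]].
      by rewrite r13 in found.
    have [e [eE Re Le]] := LE g gN.
    have eZ : in_Z k e (level (intersection_closure (edges Hc)) e) by rewrite -(badE g).
    have mZ : min_Z k e (level (intersection_closure (edges Hc)) e).
      split=> // e' l /ofZ[i [iN bi <-]]; rewrite -Le; exact: gmin.
    have ng : rowi n (mem_at s2) g != set0.
      rewrite keep // Re -card_gt0 card_imset // ltnW //.
      exact: min_Z_card k0 mZ.
    apply: wp_conseq (wp_group_rows n0 rn2 r32 r16 gN ng) _ _; first by lia.
    move=> s3 [r rS R3] [fr3 _]; split; rewrite ?fr3 //.
    rewrite keep // Re in rS R3.
    have R3' i : i < N -> rowi n (mem_at s3) i = merged (vc @: e) r (rowi n M i).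
      by move=> iN; rewrite R3 // keep.
    have [v' enc'] := encodes_group mN encc rS R3'.
    have st : kernelize_step k Hc (group e).
      by apply/kernelize_stepP; exists e, (level (intersection_closure (edges Hc)) e).
    have [r' f' _ lt] := kernelize_step_invariant k0 rHc fHc st.
    exists (group e), v'; split=> //; last first.
      right; split; last exact: leq_trans lt _.
      exact: (elimN eqP found).
    by move=> Hr /(kernelize_next st)/toH.
  move=> r13; apply: wp_skip; last by lia.
  split=> //; exists Hc, vc; split=> //.
    case: encc => h1 h2 h3 h4; split=> //; last by rewrite keep.
      by rewrite -h2; apply: eq_imset => i; rewrite keep // (ltn_trans (ltn_ord i)) // ltnW.
    by rewrite -h3; apply: eq_imset => i; rewrite keep.
  left; split=> // e l; apply/negP => /ofZ[i [iN bi _]].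
  by case: res => [[_ nb]|[//]]; case/negP: (nb i iN).
apply: (@wp_seq _ _ 2 (#|vertex H|.+1 * (c1 + 2) + 2) _ (fun s1 => s1 = setr s 13 1)).
- by apply: wp_assign.
- move=> _ -> _.
  have J0 : J #|vertex H|.+1 (setr s 13 1).
    by split=> //; exists H, v; split=> //; right.
  apply: wp_conseq (wp_while step J0) _ _; first by rewrite /=; lia.
  move=> s1 [/= e [b [_ _ _ [Hc [vc [_ _ encc toH [[_ nZ]|[/(_ e)]]]]]]]] // _.
  by exists Hc, vc; split=> //; apply: toH; apply: kernelize_stop.
- have vn : #|vertex H| <= n.
    by rewrite -[X in _ <= X]card_ord; apply: (leq_card v); case: enc.
  (* Each iteration but the last loses a vertex, so there are at most n + 1 <= 2n of them. *)
  have : #|vertex H|.+1 * (c1 + 2) <= (2 * n) * (c1 + 2) by rewrite leq_mul2r; lia.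
  have : c1 + 2 <= 900 * (n * N.+1 ^ 2 * d.+3).
    rewrite /c1 -mulnn; nia.
  rewrite expnMn -[n ^ 2]mulnn; nia.
Qed.

(** * Writing the result out *)

Definition emit_row :=
  cols (If (Mem (Add (Add (Reg 4) (Reg 0)) (Reg 5)))
          (Seq (If (Mem (Add (Reg 7) (Reg 5))) (Store (Reg 16) (Lit 1)) (Store (Reg 16) (Lit 0)))
               (Assign 16 (Add (Reg 16) (Lit 1))))
          Skip).

Definition written (out : seq nat) s :=
  reg s 16 = size out /\ forall a, a < size out -> mem_at s a = nth 0 out a.

Definition live_cells (S A : nat -> bool) j :=
  [seq nat_of_bool (A x) | x <- iota 0 j & S x].

Lemma live_cellsS S A j : live_cells S A j.+1 =
  if S j then rcons (live_cells S A j) (A j) else live_cells S A j.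
Proof.
rewrite /live_cells -addn1 iotaD filter_cat map_cat /=.
by case: (S j); rewrite ?cats0 ?cats1.
Qed.

Lemma size_live_cells S A j : size (live_cells S A j) <= j.
Proof. by rewrite size_map size_filter (leq_trans (count_size _ _)) ?size_iota. Qed.

(** The output overwrites the matrix from address 0 on. It has at most as many cells as have been
    read, so the write position never passes the cell being read. *)
Lemma wp_emit_row n m p (M : nat -> nat) out s : 0 < n -> p < m ->
  reg s 0 = n -> reg s 4 = m * n -> reg s 7 = p * n ->
  written out s -> size out <= p * n ->
  (forall a, p * n <= a -> mem_at s a = M a) ->
  wp emit_row (50 * n) (fun s' =>
    written (out ++ live_cells (fun x => M (m.+1 * n + x) != 0) (fun x => M (p * n + x) != 0) n) s' /\
    (forall a, p.+1 * n <= a -> mem_at s' a = M a)) s.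
Proof.
move=> n0 pm rn r4 r7 wr op same.
set S := fun x => M (m.+1 * n + x) != 0; set A := fun x => M (p * n + x) != 0.
have pmn : p.+1 * n <= m * n by rewrite leq_mul2r pm orbT.
rewrite mulSn in pmn.
apply: wp_conseq (@wp_cols (fun j s1 => written (out ++ live_cells S A j) s1 /\
  (forall a, p * n + j <= a -> mem_at s1 a = M a)) n 25 (50 * n) _ s _ _ _ _ _ _) (leqnn _) _ => //; last first.
- by move=> s1 [h1 h2] _; split=> // a; rewrite mulSn addnC => /h2.
- by lia.
- move=> j s1 jn [fr _] r5 [[r16 wr1] same1].
  have [rn1 r41 r71] : [/\ reg s1 0 = n, reg s1 4 = m * n & reg s1 7 = p * n] by rewrite !fr.
  have sz : size (out ++ live_cells S A j) <= p * n + j.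
    by rewrite size_cat leq_add // size_live_cells.
  have eS : mem_at s1 (m * n + n + j) = M (m.+1 * n + j).
    by rewrite same1 ?mulSn ?[m * n + n]addnC //; lia.
  have eA : mem_at s1 (p * n + j) = M (p * n + j) by rewrite same1.
  apply: (@wp_if _ _ _ 15) => //=; rewrite r41 rn1 r5 eS => h.
    apply: (@wp_seq _ _ 9 5 _ (fun s2 => mem_at s2 = update (mem_at s1)
        (size (out ++ live_cells S A j)) (A j))) => //.
      apply: (@wp_if _ _ _ 4) => //=; rewrite r71 r5 eA => h2.
        by apply: wp_store => //=; rewrite /= r16 /A h2.
      by apply: wp_store => //=; rewrite /= r16 /A h2.
    move=> s2 m2 [fr2 _]; apply: wp_assign => //; rewrite live_cellsS /S h.
    rewrite -rcons_cat -/S; split; first split.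
    - by rewrite /= fr2 // r16 size_rcons addn1.
    - move=> a; rewrite size_rcons /= m2 nth_rcons /= ltnS => ale.
      by case: ltngtP ale => // al _; rewrite wr1.
    - move=> a ale; rewrite /= m2 /= same1; last by lia.
      by case: eqP => // ea; move: ale; rewrite ea; lia.
  apply: wp_skip => //; rewrite live_cellsS /S h /=; split=> //= a ale.
  by apply: same1; lia.
- by rewrite /= cats0; split=> // a; rewrite addn0; apply: same.
Qed.

(** A row is dropped if an equal edge row comes later: earlier rows may be overwritten by then.
    [undup] likewise keeps last occurrences. *)
Definition emit :=
  Seq (Assign 16 (Lit 0)) (Seq (Assign 17 (Lit 0)) (Seq
    (rowloop 7 (Lit 0) (Reg 4)
      (Seq (Assign 10 (Lit 1))
      (Seq (rowloop 9 (Add (Reg 7) (Reg 0)) (Reg 4)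
              (Seq (eq_rows 7 9) (If (Reg 6) (Assign 10 (Lit 0)) Skip)))
           (If (Reg 10) (Seq (Assign 17 (Add (Reg 17) (Lit 1))) emit_row) Skip))))
    (Seq (Assign 7 (Add (Reg 4) (Reg 0)))
    (Seq count_row
    (Seq (Assign 0 (Reg 15)) (Assign 1 (Reg 17))))))).

Definition live n M m := [seq x : 'I_n <- enum 'I_n | x \in rowi n M m.+1].

Definition cells n M m (A : {set 'I_n}) := [seq nat_of_bool (x \in A) | x <- live n M m].

Lemma live_cells_cells n M m p :
  live_cells (fun x => M (m.+1 * n + x) != 0) (fun x => M (p * n + x) != 0) n
    = cells M m (rowi n M p).
Proof.
rewrite /live_cells -val_enum_ord filter_map -map_comp /cells /live.
rewrite (eq_filter (a2 := fun x : 'I_n => x \in rowi n M m.+1)) => [|x]; last by rewrite !inE.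
by apply: eq_map => x; rewrite !inE.
Qed.

Lemma rowi_above n (M M' : nat -> nat) p i :
  (forall a, p * n <= a -> M' a = M a) -> p <= i -> rowi n M' i = rowi n M i.
Proof.
move=> h pi; apply: row_ext => j jn; apply: h.
by rewrite (leq_trans _ (leq_addr _ _)) // leq_mul2r pi orbT.
Qed.

Lemma wp_emit n m s : 0 < n -> reg s 0 = n -> reg s 4 = m * n ->
  let M := mem_at s in
  let U := undup [seq rowi n M i | i <- iota 0 m] in
  wp emit (400 * n * m.+1 ^ 2) (fun s' =>
    [/\ reg s' 0 = #|rowi n M m.+1|, reg s' 1 = size U &
        forall a, a < size (flatten [seq cells M m A | A <- U]) ->
          mem_at s' a = nth 0 (flatten [seq cells M m A | A <- U]) a]) s.
Proof.
move=> n0 rn r4 M U; set R := rowi n M.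
pose inv p s1 := exists ks, [/\ ks ++ undup [seq R i | i <- iota p (m - p)] = U,
   written (flatten [seq cells M m A | A <- ks]) s1,
   reg s1 17 = size ks,
   size (flatten [seq cells M m A | A <- ks]) <= p * n &
   forall a, p * n <= a -> mem_at s1 a = M a].
apply: (@wp_seq _ _ 2 (300 * n * m.+1 ^ 2 + 90 * n) _ (fun s1 => s1 = setr s 16 0)); last by rewrite -mulnn; nia.
  by apply: wp_assign.
move=> _ -> _; set s1 := setr _ _ _.
apply: (@wp_seq _ _ 2 (300 * n * m.+1 ^ 2 + 85 * n) _ (fun s2 => s2 = setr s1 17 0)); last by lia.
  by apply: wp_assign.
move=> _ -> _; set s2 := setr _ _ _.
apply: (@wp_seq _ _ (300 * n * m.+1 ^ 2) (80 * n) _ (inv m)); last by lia.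
  apply: (@wp_rowloop inv n 0 m (m * (90 * n + 20) + 50 * n + 40)) => //.
  - by move=> s3 [fr _]; rewrite /= fr.
  - by exists [::]; rewrite subn0; split.
  - move=> p s3 _ pm [fr _] r7 [ks [ksU wr r17 sz same]].
    have [rn3 r43] : reg s3 0 = n /\ reg s3 4 = m * n by rewrite !fr.
    apply: (@wp_seq _ _ 2 (m * (90 * n + 20) + 50 * n + 37) _ (fun s4 => s4 = setr s3 10 1)); last by lia.
      by apply: wp_assign.
    move=> _ -> _; set s4 := setr _ _ _.
    pose rest := [seq R i | i <- iota p.+1 (m - p.+1)].
    apply: (@wp_seq _ _ (m * (90 * n + 20) + 20) (50 * n + 16) _ (fun s5 => reg s5 10 = (R p \notin rest))); last by lia.
      pose Iq q (s5 : state) := reg s5 10 = (R p \notin [seq R i | i <- iota p.+1 (q - p.+1)]).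
      apply: (@wp_rowloop Iq n p.+1 m (90 * n + 8)) => //.
      + by rewrite /= r7 rn3 mulSn addnC.
      + by move=> s5 [fr5 _]; rewrite /= fr5.
      + by rewrite /Iq subnn.
      + move=> q s5 pq qm [fr5 fm5] r9 r10.
        have [rn5 r75] : reg s5 0 = n /\ reg s5 7 = p * n by rewrite !fr5.
        apply: (wp_seq (c2 := 5) (@wp_eq_rows n 7 9 _ _ s5 rn5 n0 isT isT r75 r9)); last by lia.
        move=> s6; rewrite fm5 // -!/(rowi _ _ _) !(rowi_above same) ?(ltnW pq) // => r6 [fr6 _].
        have qE : [seq R i | i <- iota p.+1 (q.+1 - p.+1)]
            = rcons [seq R i | i <- iota p.+1 (q - p.+1)] (R q).
          by rewrite subSn // -[(q - p.+1).+1]addn1 iotaD map_cat /= cats1 subnKC.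
        apply: (@wp_if _ _ _ 3) => //=; rewrite r6 => h.
          by apply: wp_assign => //; rewrite /Iq qE mem_rcons inE /R (nat_of_bool_neq0 h).
        apply: wp_skip => //; rewrite /Iq qE mem_rcons inE /R (negbTE (nat_of_bool_eq0 h)).
        by rewrite /= fr6.
      + by rewrite /=; nia.
    move=> s5 r10 [fr5 fm5].
    have iE : undup [seq R i | i <- iota p (m - p)] =
        if R p \in rest then undup rest else R p :: undup rest.
      by rewrite (_ : m - p = (m - p.+1).+1) //; lia.
    rewrite iE in ksU.
    have wr5 : written (flatten [seq cells M m A | A <- ks]) s5.
      by case: wr => h1 h2; split; [rewrite fr5 | rewrite fm5].
    have r175 : reg s5 17 = size ks by rewrite fr5.
    have le_n : p * n <= p.+1 * n by rewrite leq_mul2r leqnSn orbT.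
    apply: (@wp_if _ _ _ (50 * n + 12)) => /=; rewrite ?r10; last by lia.
      move=> /nat_of_bool_neq0 new; rewrite (negbTE new) in ksU.
      apply: (@wp_seq _ _ 4 (50 * n) _ (fun s6 => s6 = setr s5 17 (size ks).+1)); last by lia.
        by apply: wp_assign => //=; rewrite r175 addn1.
      move=> _ -> _; set s6 := setr _ _ _.
      have sm6 a : p * n <= a -> mem_at s6 a = M a by rewrite /= fm5 //; apply: same.
      have e0 : reg s6 0 = n by rewrite /= fr5.
      have e4 : reg s6 4 = m * n by rewrite /= fr5.
      have e7 : reg s6 7 = p * n by rewrite /= fr5.
      apply: wp_conseq (@wp_emit_row n m p M _ s6 n0 pm e0 e4 e7 wr5 sz sm6) (leqnn _) _.
      rewrite live_cells_cells => s7 [wr7 sm7] [fr7 _]; exists (rcons ks (R p)).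
      rewrite map_rcons flatten_rcons cat_rcons size_rcons; split=> //.
      + by rewrite /= fr7.
      + rewrite size_cat mulSn addnC leq_add //.
        by rewrite -live_cells_cells size_live_cells.
    move=> /nat_of_bool_eq0; rewrite negbK => old; rewrite old in ksU.
    apply: wp_skip; last by lia.
    exists ks; split=> //=; first exact: leq_trans sz le_n.
    by move=> a ale; rewrite fm5 //; apply: same; apply: leq_trans ale.
  - by rewrite /= -mulnn; nia.
move=> s3 [ks [ksU [r16 wr] r17 sz same]] [fr3 _].
rewrite subnn cats0 in ksU.
apply: (@wp_seq _ _ 4 (70 * n) _ (fun s4 => s4 = setr s3 7 (m.+1 * n))); last by lia.
  by apply: wp_assign => //=; rewrite !fr3 //= r4 rn mulSn addnC.
move=> _ -> _; set s4 := setr _ _ _.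
have e0 : reg s4 0 = n by rewrite /= fr3.
have e7 : reg s4 7 = m.+1 * n by [].
apply: (wp_seq (c2 := 6) (wp_count_row n0 e0 e7)); last by lia.
move=> s5; rewrite [mem_at s4]/= (rowi_above same) // => r15 [fr5 fm5].
apply: (@wp_seq _ _ 2 2 _ (fun s6 => s6 = setr s5 0 #|rowi n M m.+1|)) => //.
  by apply: wp_assign => //=; rewrite r15.
move=> _ -> _; apply: wp_assign => //; split=> //=.
  by rewrite fr5 //= r17 -ksU.
by move=> a; rewrite fm5 //= -ksU; apply: wr.
Qed.

Lemma nth_flatten_const (c : nat) (ss : seq (seq nat)) a b :
  all (fun r => size r == c) ss -> a < size ss -> b < c ->
  nth 0 (flatten ss) (a * c + b) = nth 0 (nth [::] ss a) b.
Proof.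
elim: ss a => // r ss IH [|a] /= /andP[/eqP sr al] asz bc; rewrite nth_cat sr.
  by rewrite mul0n add0n bc.
rewrite mulSn -addnA ltnNge leq_addr /= addKn; exact: IH.
Qed.

Lemma size_flatten_const (c : nat) (ss : seq (seq nat)) :
  all (fun r => size r == c) ss -> size (flatten ss) = size ss * c.
Proof. by elim: ss => //= r ss IH /andP[/eqP sr al]; rewrite size_cat sr IH. Qed.

(** The vertices are enumerated by the live columns in increasing order, the edges by the distinct
    rows in the order of [U]. *)
Lemma encodes_represents n m N (M : nat -> nat) H (v : vertex H -> 'I_n) s :
  0 < n -> encodes m N v (rowi n M) ->
  let U := undup [seq rowi n M i | i <- iota 0 m] in
  reg s 0 = #|rowi n M m.+1| -> reg s 1 = size U ->
  (forall a, a < size (flatten [seq cells M m A | A <- U]) ->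
     mem_at s a = nth 0 (flatten [seq cells M m A | A <- U]) a) ->
  represents s H.
Proof.
move=> n0 [vi Re _ Rm] U r0 r1 out.
have cV : #|rowi n M m.+1| = #|vertex H| by rewrite Rm card_imset // cardsT.
have uU : uniq U by apply: undup_uniq.
have memU A : (A \in U) = (A \in [set v @: e | e : {set vertex H} in edges H]).
  rewrite -Re mem_undup; apply/mapP/imsetP => -[i].
    by rewrite mem_iota => /andP[_ im] ->; exists (Ordinal im).
  by move=> _ ->; exists (val i); rewrite // mem_iota /= ltn_ord.
have cE : size U = #|edges H|.
  rewrite -(card_imset _ (imset_inj vi)) -(card_uniqP uU).
  by apply: eq_card => A; rewrite -memU.
have uL : uniq (live n M m) by rewrite filter_uniq ?enum_uniq.
have memL x : (x \in live n M m) = (x \in v @: setT).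
  by rewrite mem_filter mem_enum andbT Rm.
have sL : size (live n M m) = #|vertex H|.
  rewrite -(card_uniqP uL) -cV; apply: eq_card => x.
  by rewrite memL -Rm.
have sz (A : {set 'I_n}) : size (cells M m A) = #|vertex H| by rewrite size_map sL.
have al : all (fun r => size r == #|vertex H|) [seq cells M m A | A <- U].
  by apply/allP => r /mapP[A _ ->]; rewrite sz.
pose x0 : 'I_n := Ordinal n0.
have /fin_all_exists[vv vvP] : forall j : 'I_#|vertex H|,
    exists x, v x = nth x0 (live n M m) j.
  move=> j; have : nth x0 (live n M m) j \in live n M m by rewrite mem_nth // sL.
  by rewrite memL => /imsetP[x _ ->]; exists x.
have /fin_all_exists2[ff ffE ffP] : forall i : 'I_#|edges H|,
    exists2 e : {set vertex H}, e \in edges H & v @: e = nth set0 U i.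
  move=> i; have : nth set0 U i \in U by rewrite mem_nth // cE.
  by rewrite memU => /imsetP[e eE ->]; exists e.
split; rewrite ?r0 ?r1 //; exists vv, ff; split=> //.
- move=> j j' jj; have : nth x0 (live n M m) j == nth x0 (live n M m) j' by rewrite -!vvP jj.
  by rewrite nth_uniq ?sL ?ltn_ord // => /eqP; apply: ord_inj.
- move=> i i' ii; have : nth set0 U i == nth set0 U i' by rewrite -!ffP ii.
  by rewrite nth_uniq ?cE ?ltn_ord // => /eqP; apply: ord_inj.
move=> i j; rewrite out; last first.
  rewrite (size_flatten_const al) size_map cE.
  have : i.+1 * #|vertex H| <= #|edges H| * #|vertex H| by rewrite leq_mul2r ltn_ord orbT.
  by rewrite mulSn; have := ltn_ord j; lia.
rewrite (nth_flatten_const al) ?size_map ?cE // (nth_map set0) ?cE //.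
rewrite /cells (nth_map x0) ?sL // -vvP -ffP mem_imset //.
Qed.

(** * The whole program and its running time *)

Lemma input_edges H k s : input_state s H k ->
  let n := #|vertex H| in let m := #|edges H| in
  exists w : vertex H -> 'I_n, bijective w /\
    [set rowi n (mem_at s) i | i : 'I_m] = [set w @: e | e : {set vertex H} in edges H].
Proof.
case=> [[_ _ [v [f [vi fi fE vf]]]] _ _ _] n m.
have [w vK wK] : bijective v by apply: inj_card_bij; rewrite // card_ord.
exists w; split; first by exists v.
have Ri (i : 'I_m) : rowi n (mem_at s) i = w @: f i.
  apply/setP => j; rewrite inE vf -{2}[j]vK mem_imset; last exact: can_inj wK.
  by case: (_ \in _).
have fim : [set f i | i : 'I_m] = edges H.
  apply/eqP; rewrite eqEcard card_imset // card_ord leqnn andbT.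
  by apply/subsetP => _ /imsetP[i _ ->].
rewrite -fim -imset_comp; exact: eq_imset.
Qed.

(** With n = 0 row addresses would not tell rows apart; all edges are then empty, and [H] is its own
    kernel. *)
Definition kernel_program :=
  If (Reg 0) (Seq init (Seq close_rows (Seq kernelize_rows emit))) Skip.

Lemma kernel_program_run k d H s : 0 < k -> reduced H -> flat d H ->
  input_state s H k ->
  let X := #|intersection_closure (edges H)| in
  wp kernel_program (4000 * d.+3 * (5 * (maxn 1 #|vertex H| * X)) ^ 2)
    (fun s' => exists Hr, represents s' Hr /\ kernelize_set_cover k H Hr) s.
Proof.
move=> k0 rH fH inp X; set n := #|vertex H|; set m := #|edges H|.
have [[r0 r1 _] r2 _ zero] := inp.
have X0 : 0 < X by apply/card_gt0P; exists setT; apply: closureT.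
case: (posnP n) => n0.
  apply: (@wp_if _ _ _ 1) => /=; rewrite ?r0 -/n ?n0 //=; last first.
    by rewrite -mulnn; nia.
  move=> _; apply: wp_skip => //; exists H; split; first by case: inp.
  apply: kernelize_stop => e i; rewrite /in_Z; apply/negP => /and4P[_ _ _].
  by have := max_card e; rewrite -/n n0; lia.
rewrite (maxn_idPr n0).
have [w [bw Rw]] := input_edges inp; rewrite -/n -/m in w bw Rw zero r0 r1.
have wi : injective w := bij_inj bw.
have wT : w @: setT = setT.
  by apply/eqP; rewrite eqEcard subsetT card_imset // !cardsT card_ord leqnn.
have mX : m <= X by apply: subset_leq_card; apply: sub_closure.
pose NN := (m.+2 + X).+1.
(* m + 3 + X <= 5 X, as m <= X and 1 <= X. *)
have NNX : NN <= 5 * X by rewrite /NN; lia.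
apply: (@wp_if _ _ _ (3900 * d.+3 * (n * NN) ^ 2)) => /=; rewrite ?r0; last first.
  apply: (@leq_trans (4000 * d.+3 * (n * NN) ^ 2)).
    by have : 0 < (n * NN) ^ 2; [rewrite expn_gt0 muln_gt0 n0 | nia].
  by rewrite leq_mul2l leq_exp2r // mulnCA leq_mul2l NNX !orbT.
  by move=> h; rewrite h in n0.
move=> _; have NN0 : 0 < (n * NN) ^ 2 by rewrite expn_gt0 muln_gt0 n0.
have small1 : m + n <= (n * NN) ^ 2.
  by rewrite -mulnn /NN; nia.
have small2 : n * m.+1 ^ 2 <= (n * NN) ^ 2.
  by rewrite expnMn leq_mul // ?leq_exp2r // /NN; [rewrite -mulnn leq_pmulr | lia].
apply: (wp_seq (c2 := 3800 * d.+3 * (n * NN) ^ 2) (wp_init r0 r1 n0)); last by nia.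
move=> s1 [r31 r41 m1] [fr1 _].
have r01 : reg s1 0 = n by rewrite fr1.
have Rlt i : i < m -> rowi n (mem_at s1) i = rowi n (mem_at s) i.
  move=> im; apply: (rowi_below (N := m)) => // a am; rewrite m1.
  by case: ifP => //; rewrite mulSn; lia.
have RT : rowi n (mem_at s1) m.+1 = setT.
  by rewrite /rowi (row_inside (new := fun=> 1) m1); apply/setP => j; rewrite !inE.
(* Row m lies past the input matrix, where the memory is initially zero. *)
have R0 : rowi n (mem_at s1) m = set0.
  apply/setP => j; rewrite !inE m1 zero ?leq_addr //.
  case: ifP => //; rewrite mulSn; have := ltn_ord j; lia.
have RE : edge_rows m (rowi n (mem_at s1)) = [set w @: e | e : {set vertex H} in edges H].
  by rewrite -Rw; apply: eq_imset => i; apply: Rlt.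
have CE : intersection_closure (edge_rows m (rowi n (mem_at s1)))
    = [set w @: e | e : {set vertex H} in intersection_closure (edges H)].
  by rewrite RE; apply: closure_imset => // a b; rewrite imsetI // => ? ? _ _; apply: wi.
have CX : #|intersection_closure (edge_rows m (rowi n (mem_at s1)))| = X.
  by rewrite CE card_imset //; apply: imset_inj.
have C0 : set0 \in intersection_closure (edge_rows m (rowi n (mem_at s1))).
  by rewrite CE; apply/imsetP; exists set0; rewrite ?imset0 ?reduced_closure.
rewrite addn2 in r31.
have cl := wp_close_rows n0 r01 r31 r41 R0 RT C0; rewrite CX -/NN in cl.
apply: (wp_seq (c2 := 3200 * d.+3 * (n * NN) ^ 2) cl); last by nia.
move=> s2 [N [r32 /andP[mN NNN] R2 C2]] [fr2 _].
have enc : encodes m N w (rowi n (mem_at s2)).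
  split=> //; last by rewrite R2 // RT wT.
    by rewrite -RE; apply: eq_imset => i; apply: R2; have := ltn_ord i; lia.
  by rewrite C2.
have [r02 r22] : reg s2 0 = n /\ reg s2 2 = k by rewrite !fr2 // !fr1.
have kr := wp_kernelize_rows n0 k0 mN rH fH r02 r22 r32 enc.
have NNle : 2000 * (n * N.+1) ^ 2 * d.+3 <= 2000 * (n * NN) ^ 2 * d.+3.
  by rewrite leq_mul2r leq_mul2l leq_exp2r // leq_mul2l NNN !orbT.
apply: (wp_seq (c2 := 400 * n * m.+1 ^ 2) kr); last first.
  by rewrite -mulnA; nia.
move=> s3 [Hr [vr [encr run]]] [fr3 _].
have [r03 r43] : reg s3 0 = n /\ reg s3 4 = m * n.
  by rewrite !fr3 // !fr2 // !fr1.
apply: wp_conseq (wp_emit n0 r03 r43) (leqnn _) _.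
move=> s4 [r04 r14 out] _; exists Hr; split=> //.
exact: encodes_represents n0 encr r04 r14 out.
Qed.

Theorem theorem4 :
  exists P : program, forall d : nat, 0 < d -> exists C : nat,
  forall (k : nat) (H : hypergraph),
    0 < k -> reduced H -> flat d H ->
    [/\ Acc (fun H2 H1 : hypergraph => kernelize_step k H1 H2) H,
        forall Hr : hypergraph, kernelize_set_cover k H Hr ->
          (has_cover Hr k <-> has_cover H k) /\
          hsize Hr <= C * k ^ (d ^ 2)
      & forall s : state, input_state s H k ->
          exists (t : nat) (s' : state) (Hr : hypergraph),
            [/\ exec P s t s', represents s' Hr,
                kernelize_set_cover k H Hr
              & t <= C * (maxn 1 #|vertex H|) ^ (2 * d + 2)]].
Proof.
exists kernel_program => d d0.
(* [C1] is the constant of [kernel_size]; [C2] results from [kernel_program_run] with X <= (d+2) 2^d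
   n^d. One constant has to serve both bounds, hence the sum. *)
pose C1 := 1 + d.+1 * 2 ^ d.
pose C2 := 4000 * d.+3 * (5 * (d.+2 * 2 ^ d)) ^ 2.
exists (C1 + C2) => k H k0 rH fH; split.
- exact: kernelize_acc k0 rH fH.
- move=> Hr /(kernelize_correct d0 k0 rH fH)[? size_r]; split=> //.
  by apply: leq_trans size_r _; rewrite leq_mul2r leq_addr orbT.
move=> s inp; have [t [s' [ex tc [Hr [rep run]]]]] := kernel_program_run k0 rH fH inp.
exists t, s', Hr; split=> //; apply: leq_trans tc _.
set n := maxn 1 _; set X := #|_|.
have n0 : 0 < n by rewrite leq_max.
have XB : X <= d.+2 * 2 ^ d * n ^ d.
  (* [card_closure] asks for a vertex; without any, the empty set is the only set and X = 1. *)
  case: (posnP #|vertex H|) => [V0|V0].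
    have -> : X = 1.
      apply/eqP/cards1P; exists setT; apply/setP => e; rewrite inE.
      have sub (a : {set vertex H}) : a = set0.
        by apply/eqP; rewrite -cards_eq0 -leqn0 -V0 max_card.
      by rewrite (sub e) -(sub setT) closureT eqxx.
    by rewrite !muln_gt0 !expn_gt0 n0.
  have := card_closure (reduced_closure rH) V0 (flat_level fH (closureT _)).
  have -> : #|vertex H| = n by rewrite /n (maxn_idPr V0).
  rewrite -/X expnMn -mulnA => /leq_trans; apply.
  have : 0 < 2 ^ d * n ^ d by rewrite muln_gt0 !expn_gt0 n0.
  by rewrite [d.+2 * _]mulSn; lia.
apply: (@leq_trans (C2 * n ^ (2 * d + 2))); last by rewrite leq_mul2r leq_addl orbT.
rewrite /C2 -[leqRHS]mulnA leq_mul2l; apply/orP; right.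
have -> : n ^ (2 * d + 2) = (n * n ^ d) ^ 2 by rewrite -expnS -expnM; congr (_ ^ _); lia.
by rewrite -expnMn leq_exp2r // -[leqRHS]mulnA leq_mul2l /= mulnCA leq_mul2l XB orbT.
Qed.
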